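(* Let $A$ be a locally $C^*$-algebra and let $E$ and $F$ be two Hilbert $A$-modules. (1) The complete locally convex spaces $L_{M(A)}(M(E),M(F))$ and $L_A(E,F)$ are isomorphic. (2) The locally $C^*$-algebras $L_{M(A)}(M(E))$ and $L_A(E)$ are isomorphic.
   Context: A locally $C^*$-algebra is a complete Hausdorff complex topological $*$-algebra $A$ whose topology is determined by its continuous $C^*$-seminorms; $S(A)$ is the set of all continuous $C^*$-seminorms on $A$. For $p\in S(A)$, $A_p=A/\ker p$ is a $C^*$-algebra with the norm induced by $p$. Two locally $C^*$-algebras are isomorphic if there is a bijective map $\Phi$ between them such that $\Phi$ and $\Phi^{-1}$ are continuous morphisms of $*$-algebras. Two locally convex spaces are isomorphic if there is a linear homeomorphism between them. A pre-Hilbert $A$-module is a complex vector space $E$ which is a right $A$-module (compatibly with the complex algebra structure), with an $A$-valued inner product $\langle\cdot,\cdot\rangle:E\times E\to A$ which is $\mathbb C$- and $A$-linear in the second variable, with $\langle\xi,\eta\rangle^*=\langle\eta,\xi\rangle$, $\langle\xi,\xi\rangle\ge 0$, and $\langle\xi,\xi\rangle=0$ iff $\xi=0$. It is a Hilbert $A$-module if it is complete for the topology given by the seminorms $\overline p_E(\xi)=\sqrt{p(\langle\xi,\xi\rangle)}$, $p\in S(A)$. $A$ is a Hilbert $A$-module with $\langle a,b\rangle=a^*b$. For $p\in S(A)$, $E_p=E/\ker\overline p_E$ is a Hilbert $A_p$-module with the induced operations; $\sigma_p^E:E\to E_p$ is the quotient map. An $A$-module morphism $T:E\to F$ between Hilbert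 $A$-modules is adjointable if there is an $A$-module morphism $T^*:F\to E$ with $\langle T\xi,\eta\rangle=\langle\xi,T^*\eta\rangle$ for all $\xi\in E,\eta\in F$. $L_A(E,F)$ is the set of all such morphisms, a complete locally convex space with the topology given by the seminorms $\widetilde p_{L_A(E,F)}(T)=\|T_p\|$, $p\in S(A)$, where $T_p\in L_{A_p}(E_p,F_p)$ is the induced operator $T_p(\sigma_p^E(\xi))=\sigma_p^F(T\xi)$; $L_A(E)=L_A(E,E)$, which is a locally $C^*$-algebra (product: composition; involution: adjoint). The multiplier algebra $M(A)$ is identified with the locally $C^*$-algebra $L_A(A)$. The multiplier module of a Hilbert $A$-module $E$ is $M(E)=L_A(A,E)$, a Hilbert $M(A)$-module with action $t\cdot m=t\circ m$ and inner product $\langle s,t\rangle_{M(A)}=s^*\circ t$; its topology coincides with that given by the seminorms $\widetilde p_{L_A(A,E)}$, $p\in S(A)$. $L_{M(A)}(M(E),M(F))$ is the space of adjointable $M(A)$-module morphisms between these Hilbert $M(A)$-modules, topologized by the seminorms $\widetilde p_{L_{M(A)}(M(E),M(F))}(T)=\sup\{\overline p_{M(F)}(T(s)) : s\in M(E),\ \overline p_{M(E)}(s)\le 1\}$, $p\in S(A)$, where $\overline p_{M(E)}(s)=\sqrt{p_{M(A)}(\langle s,s\rangle_{M(A)})}$ with $p_{M(A)}=\widetilde p_{L_A(A)}$, and similarly for $\overline p_{M(F)}$ (that is, by the norms of the operators induced by $T$ from $M(E)/\ker\overline p_{M(E)}$ to $M(F)/\ker\overline p_{M(F)}$; it suffices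 to use these seminorms coming from $p\in S(A)$). $L_{M(A)}(M(E))=L_{M(A)}(M(E),M(E))$, which is a locally $C^*$-algebra (product: composition; involution: adjoint). *)

(* Defs.v *)
From HB Require Import structures.
From mathcomp Require Import all_boot all_order all_algebra.
From mathcomp Require Import complex.
From mathcomp Require Import all_classical all_reals all_analysis.

Set Implicit Arguments.
Unset Strict Implicit.
Unset Printing Implicit Defensive.

Import Order.TTheory GRing.Theory Num.Theory.
Import numFieldNormedType.Exports.

Local Open Scope classical_set_scope.
Local Open Scope ring_scope.

(* smul has no unit: A is not assumed unital. *)
HB.mixin Record isStarAlg (R : realType) A & GRing.Lmodule R[i] A := {
  smul : A -> A -> A;
  star : A -> A;
  smulA : forall a b c, smul a (smul b c) = smul (smul a b) c;
  smulDl : forall a b c, smul (a + b) c = smul a c + smul b c;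
  smulDr : forall a b c, smul a (b + c) = smul a b + smul a c;
  smulZl : forall (k : R[i]) a b, smul (k *: a) b = k *: smul a b;
  smulZr : forall (k : R[i]) a b, smul a (k *: b) = k *: smul a b;
  starD : forall a b, star (a + b) = star a + star b;
  starZ : forall (k : R[i]) a, star (k *: a) = conjc k *: star a;
  starM : forall a b, star (smul a b) = smul (star b) (star a);
  starK : forall a, star (star a) = a
}.

#[short(type="starAlgType")]
HB.structure Definition StarAlg (R : realType) :=
  {A of GRing.Lmodule R[i] A & isStarAlg R A}.

#[short(type="preTopStarAlgType")]
HB.structure Definition PreTopStarAlg (R : realType) :=
  {A of Topological A & StarAlg R A}.

(* Seminorms are extended-real-valued because operator norms are defined below
   as suprema in \bar R. *)

Definition seminorm_entourage (R : realType) (V : zmodType)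
    (Q : set (V -> \bar R)) : set_system (V * V) :=
  [set U | exists (P : set (V -> \bar R)) (e : R),
     [/\ finite_set P, P `<=` Q, 0 < e &
         forall x y, (forall q, P q -> (q (x - y)%R < e%:E)%E) -> U (x, y)]].

Definition seminorm_space (R : realType) (V : lmodType R[i])
  (Q : set (V -> \bar R)) : Type := V.

Section SeminormSpace.
Context (R : realType) (V : lmodType R[i]) (Q : set (V -> \bar R)).

Definition seminorm_balls : set (set V) :=
  [set B | exists q x (e : R),
     [/\ Q q, 0 < e & B = [set y | (q (y - x)%R < e%:E)%E]]].

HB.instance Definition _ := GRing.Lmodule.copy (seminorm_space Q) V.
HB.instance Definition _ :=
  isSubBaseTopological.Build (seminorm_space Q) seminorm_balls id.

End SeminormSpace.

HB.instance Definition _ (R : realType) (A : starAlgType R)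
  (Q : set (A -> \bar R)) := StarAlg.copy (seminorm_space Q) A.

(* completeType is not used, because the library has no join of pointedType and
   lmodType. *)
Definition complete_space (T : uniformType) :=
  forall F : set_system T, ProperFilter F -> cauchy F -> exists x : T, F --> x.

Definition Cstar_seminorm (R : realType) (A : starAlgType R) (p : A -> R) :=
  [/\ (forall a, 0 <= p a),
      (forall a b, p (a + b) <= p a + p b),
      (forall (k : R[i]) a, p (k *: a) = ComplexField.Normc.normc k * p a),
      (forall a b, p (smul a b) <= p a * p b) &
      (forall a, p (smul (star a) a) = p a ^+ 2)].

(* S(A) *)
Definition cont_Cstar_seminorms (R : realType) (A : preTopStarAlgType R) :
    set (A -> R) :=
  [set p | Cstar_seminorm p /\ continuous p].
Arguments cont_Cstar_seminorms {R} A _.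

Definition cont_Cstar_seminormsE (R : realType) (A : preTopStarAlgType R) :
    set (A -> \bar R) :=
  [set (fun a => (p a)%:E) | p in cont_Cstar_seminorms A].
Arguments cont_Cstar_seminormsE {R} A _.

(* The continuity of the algebraic operations is not listed, because it follows
   from seminormsP. *)
HB.mixin Record isLocallyCstar (R : realType) A
    & Uniform A & StarAlg R A := {
  locallyCstar_complete : complete_space A;
  locallyCstar_hausdorff : hausdorff_space A;
  seminormsP :
    @entourage A = seminorm_entourage (cont_Cstar_seminormsE A)
}.

#[short(type="locallyCstarType")]
HB.structure Definition LocallyCstar (R : realType) :=
  {A of Uniform A & StarAlg R A & isLocallyCstar R A}.

Definition Cstar_pos (R : realType) (A : starAlgType R) (a : A) :=
  exists b : A, a = smul (star b) b.

(* Right modules over a *-algebra A with an A-valued inner product.  A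
   pre-Hilbert module has moreover positive <x, x>; this is required in
   isHilbertMod, where A is a locally C*-algebra.  The definition of
   adjointable operators and of M(E) does not use positivity. *)

HB.mixin Record isInnerMod (R : realType) (A : starAlgType R) E
    & GRing.Lmodule R[i] E := {
  ract : E -> A -> E;
  inner : E -> E -> A;
  ractDl : forall x y a, ract (x + y) a = ract x a + ract y a;
  ractDr : forall x a b, ract x (a + b) = ract x a + ract x b;
  ractA : forall x a b, ract x (smul a b) = ract (ract x a) b;
  ractZl : forall (k : R[i]) x a, ract (k *: x) a = k *: ract x a;
  ractZr : forall (k : R[i]) x a, ract x (k *: a) = k *: ract x a;
  innerDr : forall x y z, inner x (y + z) = inner x y + inner x z;
  innerZr : forall (k : R[i]) x y, inner x (k *: y) = k *: inner x y;
  inner_ract : forall x y a, inner x (ract y a) = smul (inner x y) a;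
  inner_star : forall x y, star (inner x y) = inner y x;
  inner_eq0 : forall x, inner x x = 0 <-> x = 0
}.

#[short(type="innerModType")]
HB.structure Definition InnerMod (R : realType) (A : starAlgType R) :=
  {E of GRing.Lmodule R[i] E & isInnerMod R A E}.

Definition hnorm (R : realType) (A : starAlgType R) (E : innerModType A)
  (p : A -> \bar R) (x : E) : \bar R := sqrte (p (inner x x)).

HB.mixin Record isHilbertMod (R : realType) (A : locallyCstarType R) E
    & Uniform E & InnerMod R A E := {
  hilbert_complete : complete_space E;
  inner_ge0 : forall x : E, Cstar_pos (inner x x);
  hnormsP : @entourage E =
    seminorm_entourage [set @hnorm R A E p | p in cont_Cstar_seminormsE A]
}.

#[short(type="hilbertModType")]
HB.structure Definition HilbertMod (R : realType) (A : locallyCstarType R) :=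
  {E of Uniform E & InnerMod R A E & isHilbertMod R A E}.

(* A as a Hilbert module over itself, with <a, b> = a^* b. *)

Definition regmod (R : realType) (A : locallyCstarType R) : Type := A.

Section RegularModule.
Context (R : realType) (A : locallyCstarType R).

HB.instance Definition _ := GRing.Lmodule.copy (regmod A) A.
HB.instance Definition _ := Uniform.copy (regmod A) A.

Lemma cont_Cstar_seminorms_eq0 (a : A) :
  (forall p, cont_Cstar_seminorms A p -> p a = 0) -> a = 0.
Proof.
move=> pa0; apply: (@locallyCstar_hausdorff R A) => U V.
rewrite -!nbhs_entourageE => -[U' entU' U'U] [V' entV' V'V].
exists a; split; first by apply/U'U/xsectionP; exact: entourage_refl.
apply/V'V/xsectionP; move: entV'; rewrite seminormsP.
move=> [P [e [_ PS e0 PV']]]; apply: PV' => q /PS[p Sp <-].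
have [[_ _ pZ _ _] _] := Sp.
rewrite sub0r -scaleN1r pZ pa0// mulr0 lte_fin//.
Qed.

Let inner_eq0 (a : A) : smul (star a) a = 0 <-> a = 0.
Proof.
split=> [aa0|->]; last by rewrite -[X in smul _ X](scale0r 0) smulZr scale0r.
apply: cont_Cstar_seminorms_eq0 => p [[_ _ pZ _ pC] _].
apply/eqP; rewrite -sqrf_eq0 -pC aa0 -(scale0r 0) pZ.
by rewrite ComplexField.Normc.normc0 mul0r.
Qed.

Let inner_star (a b : A) :
  star (smul (star a) b) = smul (star b) a.
Proof. by rewrite starM starK. Qed.

HB.instance Definition _ := @isInnerMod.Build R A (regmod A)
  (@smul R A) (fun a b => smul (star a) b)
  (@smulDl R A) (@smulDr R A) (@smulA R A) (@smulZl R A)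
  (fun k a b => smulZr k a b) (fun a => smulDr (star a))
  (fun k a b => smulZr k (star a) b) (fun a b c => smulA (star a) b c)
  inner_star inner_eq0.

Let inner_ge0 (a : regmod A) : Cstar_pos (inner a a : A).
Proof. by exists a. Qed.

Let hnormsP : @entourage (regmod A) =
  seminorm_entourage [set @hnorm R A (regmod A) p | p in cont_Cstar_seminormsE A].
Proof.
rewrite [LHS](@seminormsP R A); congr seminorm_entourage.
suff hE p : cont_Cstar_seminorms A p ->
    @hnorm R A (regmod A) (fun a => (p a)%:E) = (fun a => (p a)%:E).
  apply/seteqP; split=> [_ [p Sp <-]|_ [_ [p Sp <-] <-]].
    by exists (fun a => (p a)%:E); [exists p|exact: hE].
  by rewrite hE//; exists p.
move=> [[p0 _ _ _ pC] _]; apply/funext => a.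
by rewrite /hnorm/= pC sqrtr_sqr ger0_norm.
Qed.

HB.instance Definition _ :=
  @isHilbertMod.Build R A (regmod A) (@locallyCstar_complete R A)
    inner_ge0 hnormsP.

End RegularModule.

Section Adjointable.
Context (R : realType) (A : starAlgType R).

Definition module_morphism (E F : innerModType A) (T : E -> F) :=
  linear T /\ forall x a, T (ract x a) = ract (T x) a.

Definition is_adjoint (E F : innerModType A) (T : E -> F) (S : F -> E) :=
  forall x y, inner (T x) y = inner x (S y).

Definition adjointable (E F : innerModType A) : {pred E -> F} := fun T =>
  `[< module_morphism T /\ exists2 S, module_morphism S & is_adjoint T S >].

Lemma fct_combE (E F : innerModType A) (k : R[i]) (S T : E -> F) x :
  (k *: S + T) x = k *: S x + T x.
Proof. by []. Qed.

Lemma module_morphism_comb (E F : innerModType A) (k : R[i]) (S T : E -> F) :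
  module_morphism S -> module_morphism T -> module_morphism (k *: S + T).
Proof.
move=> [Sl Sa] [Tl Ta]; split=> [c x y|x a].
  rewrite !fct_combE Sl Tl !scalerDr -!addrA; congr (_ + _).
    by rewrite !scalerA mulrC.
  by rewrite addrCA.
by rewrite !fct_combE Sa Ta ractDl ractZl.
Qed.

Lemma module_morphism0 (E F : innerModType A) :
  module_morphism (0 : E -> F).
Proof.
split=> [c x y|x a] /=; first by rewrite /GRing.zero/= scaler0 addr0.
by rewrite [LHS]/(0 : F) -[X in ract X](scale0r (0 : F)) ractZl scale0r.
Qed.

Lemma innerDl (E : innerModType A) (x y z : E) :
  inner (x + y) z = inner x z + inner y z :> A.
Proof. by rewrite -inner_star innerDr starD !inner_star. Qed.

Lemma innerZl (E : innerModType A) (k : R[i]) (x y : E) :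
  inner (k *: x) y = conjc k *: inner x y :> A.
Proof. by rewrite -inner_star innerZr starZ inner_star. Qed.

Lemma inner0l (E : innerModType A) (x : E) : inner 0 x = 0 :> A.
Proof. by rewrite -(scale0r 0) innerZl conjc0 scale0r. Qed.

Lemma inner0r (E : innerModType A) (x : E) : inner x 0 = 0 :> A.
Proof. by rewrite -(scale0r 0) innerZr scale0r. Qed.

Lemma inner_extr (E : innerModType A) (x y : E) :
  (forall z, inner z x = inner z y :> A) -> x = y.
Proof.
move=> xy; apply/eqP; rewrite -subr_eq0; apply/eqP.
apply/(@inner_eq0 R A) => /=.
have xyw w : inner w (x - y) = 0 :> A.
  by rewrite -scaleN1r innerDr innerZr xy scaleN1r subrr.
exact: xyw.
Qed.

Lemma is_adjoint_comb (E F : innerModType A) (k : R[i]) (T1 T2 : E -> F) S1 S2 :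
  is_adjoint T1 S1 -> is_adjoint T2 S2 ->
  is_adjoint (k *: T1 + T2) (conjc k *: S1 + S2).
Proof.
move=> h1 h2 x y; rewrite !fct_combE innerDl innerZl h1 h2.
by rewrite innerDr innerZr.
Qed.

Lemma adjointable_submod_closed (E F : innerModType A) :
  submod_closed (@adjointable E F).
Proof.
split.
  apply/asboolP; split; first exact: module_morphism0.
  exists 0; first exact: module_morphism0.
  by move=> x y; rewrite [LHS]inner0l [RHS]inner0r.
move=> k T1 T2 /asboolP[m1 [S1 n1 a1]] /asboolP[m2 [S2 n2 a2]].
apply/asboolP; split; first exact: module_morphism_comb.
exists (conjc k *: S1 + S2); first exact: module_morphism_comb.
exact: is_adjoint_comb.
Qed.

HB.instance Definition _ (E F : innerModType A) :=
  GRing.isSubmodClosed.Build R[i] (E -> F) (@adjointable E F)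
    (adjointable_submod_closed E F).

(* The vector space L_A(E, F), without its topology. *)
Record adj_op (E F : innerModType A) := AdjOp {
  adj_fun :> E -> F;
  adj_funP : adj_fun \in @adjointable E F
}.

HB.instance Definition _ (E F : innerModType A) :=
  [isSub for @adj_fun E F].
HB.instance Definition _ (E F : innerModType A) :=
  [Choice of adj_op E F by <:].
HB.instance Definition _ (E F : innerModType A) :=
  [SubChoice_isSubLmodule of adj_op E F by <:].

Section adjoint.
Context (E F : innerModType A).

Lemma adj_op_ext (S T : adj_op E F) : S =1 T -> S = T.
Proof. by move=> ST; apply/val_inj/funext. Qed.

Lemma adj_op_morph (T : adj_op E F) : module_morphism T.
Proof. by have /asboolP[] := adj_funP T. Qed.

Lemma adj_op_exists (T : adj_op E F) :
  exists S : adj_op F E, is_adjoint T S.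
Proof.
have /asboolP[mT [S mS TS]] := adj_funP T.
suff SP : S \in @adjointable F E by exists (AdjOp SP).
apply/asboolP; split=> //; exists (adj_fun T) => // x y.
by rewrite -inner_star -TS inner_star.
Qed.

Definition adjoint (T : adj_op E F) : adj_op F E :=
  projT1 (cid (adj_op_exists T)).

Lemma adjointP (T : adj_op E F) x y :
  inner (T x) y = inner x (adjoint T y) :> A.
Proof. exact: (projT2 (cid (adj_op_exists T))). Qed.

Lemma adjointPr (T : adj_op E F) x y :
  inner y (T x) = inner (adjoint T y) x :> A.
Proof. by rewrite -inner_star adjointP inner_star. Qed.

End adjoint.

Lemma adjoint_uniq (E F : innerModType A) (T : adj_op E F) (S : adj_op F E) :
  is_adjoint T S -> adjoint T = S.
Proof.
by move=> TS; apply: adj_op_ext => y; apply: inner_extr => z; rewrite -adjointP.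
Qed.

Lemma comp_adjointable (E F G : innerModType A) (S : adj_op F G)
  (T : adj_op E F) : S \o T \in @adjointable E G.
Proof.
have [Sl Sa] := adj_op_morph S; have [Tl Ta] := adj_op_morph T.
have [Sl' Sa'] := adj_op_morph (adjoint S).
have [Tl' Ta'] := adj_op_morph (adjoint T).
apply/asboolP; split.
  by split=> [k x y|x a] /=; rewrite ?Tl ?Sl ?Ta ?Sa.
exists (adjoint T \o adjoint S).
  by split=> [k x y|x a] /=; rewrite ?Sl' ?Tl' ?Sa' ?Ta'.
by move=> x y /=; rewrite !adjointP.
Qed.

Definition adj_comp (E F G : innerModType A) (S : adj_op F G) (T : adj_op E F) :
  adj_op E G := AdjOp (comp_adjointable S T).

Lemma adj_opD (E F : innerModType A) (S T : adj_op E F) x :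
  (S + T) x = S x + T x.
Proof. by []. Qed.

Lemma adj_opZ (E F : innerModType A) k (T : adj_op E F) x :
  (k *: T) x = k *: T x.
Proof. by []. Qed.

Lemma adj_op_D (E F : innerModType A) (T : adj_op E F) x y :
  T (x + y) = T x + T y.
Proof. by have := (adj_op_morph T).1 1 x y; rewrite !scale1r. Qed.

Lemma adj_op_0 (E F : innerModType A) (T : adj_op E F) : T 0 = 0.
Proof. by apply: (addrI (T 0)); rewrite -adj_op_D !addr0. Qed.

Lemma adj_op_Z (E F : innerModType A) (T : adj_op E F) k x :
  T (k *: x) = k *: T x.
Proof. by have := (adj_op_morph T).1 k x 0; rewrite adj_op_0 !addr0. Qed.

Lemma adjointK (E F : innerModType A) (T : adj_op E F) :
  adjoint (adjoint T) = T.
Proof. by apply: adjoint_uniq => x y; rewrite -adjointPr. Qed.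

Lemma adjoint_comp (E F G : innerModType A) (S : adj_op F G) (T : adj_op E F) :
  adjoint (adj_comp S T) = adj_comp (adjoint T) (adjoint S).
Proof. by apply: adjoint_uniq => x y /=; rewrite !adjointP. Qed.

Lemma adjointD (E F : innerModType A) (S T : adj_op E F) :
  adjoint (S + T) = adjoint S + adjoint T.
Proof.
apply: adjoint_uniq => x y.
by rewrite !adj_opD innerDl innerDr !adjointP.
Qed.

Lemma adjointZ (E F : innerModType A) k (T : adj_op E F) :
  adjoint (k *: T) = conjc k *: adjoint T.
Proof.
by apply: adjoint_uniq => x y; rewrite !adj_opZ innerZl innerZr adjointP.
Qed.

Lemma adj_compDl (E F G : innerModType A) (S S' : adj_op F G) (T : adj_op E F) :
  adj_comp (S + S') T = adj_comp S T + adj_comp S' T.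
Proof. exact: adj_op_ext. Qed.

Lemma adj_compDr (E F G : innerModType A) (S : adj_op F G) (T T' : adj_op E F) :
  adj_comp S (T + T') = adj_comp S T + adj_comp S T'.
Proof. by apply: adj_op_ext => x; exact: adj_op_D. Qed.

Lemma adj_compZl (E F G : innerModType A) k (S : adj_op F G) (T : adj_op E F) :
  adj_comp (k *: S) T = k *: adj_comp S T.
Proof. exact: adj_op_ext. Qed.

Lemma adj_compZr (E F G : innerModType A) k (S : adj_op F G) (T : adj_op E F) :
  adj_comp S (k *: T) = k *: adj_comp S T.
Proof. by apply: adj_op_ext => x; exact: adj_op_Z. Qed.

Lemma adj_compA (E F G H : innerModType A) (S : adj_op G H) (T : adj_op F G)
  (U : adj_op E F) : adj_comp S (adj_comp T U) = adj_comp (adj_comp S T) U.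
Proof. exact: adj_op_ext. Qed.

Definition endo_op (E : innerModType A) : Type := adj_op E E.

HB.instance Definition _ (E : innerModType A) :=
  GRing.Lmodule.copy (endo_op E) (adj_op E E).
HB.instance Definition _ (E : innerModType A) :=
  @isStarAlg.Build R (endo_op E) (@adj_comp E E E) (@adjoint E E)
    (@adj_compA E E E E) (@adj_compDl E E E) (@adj_compDr E E E)
    (@adj_compZl E E E) (@adj_compZr E E E) (@adjointD E E) (@adjointZ E E)
    (@adjoint_comp E E E) (@adjointK E E).

(* The norm of the operator T_p that T induces from E / ker p_E to F / ker p_F:
   the norm of the class of x in E / ker p_E is hnorm p x. *)
Definition opnorm (E F : innerModType A) (p : A -> \bar R) (T : adj_op E F) :
    \bar R :=
  ereal_sup [set hnorm p (T x) | x in [set x | (hnorm p x <= 1%:E)%E]].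

End Adjointable.

(* M(A) = L_A(A) and M(E) = L_A(A, E). *)

Definition multAlg (R : realType) (A : locallyCstarType R) : starAlgType R :=
  endo_op (regmod A).

Definition multMod (R : realType) (A : locallyCstarType R)
  (E : innerModType A) : Type := adj_op (regmod A) E.

Section MultiplierModule.
Context (R : realType) (A : locallyCstarType R) (E : innerModType A).

HB.instance Definition _ :=
  GRing.Lmodule.copy (multMod E) (adj_op (regmod A) E).

Definition mult_inner (s t : multMod E) : multAlg A := adj_comp (adjoint s) t.

Let mult_inner_eq0 (s : multMod E) : mult_inner s s = 0 <-> s = 0.
Proof.
split=> [ss0|->]; last first.
  by apply: adj_op_ext => a /=; rewrite adj_op_0.
apply: adj_op_ext => a; apply/(@inner_eq0 R A) => /=.
rewrite adjointP -[X in inner a X]/((mult_inner s s : adj_op _ _) a) ss0.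
exact: inner0r.
Qed.

Let mult_inner_star (s t : multMod E) :
  star (mult_inner s t) = mult_inner t s.
Proof. by rewrite /mult_inner /star/= adjoint_comp adjointK. Qed.

HB.instance Definition _ := @isInnerMod.Build R (multAlg A) (multMod E)
  (fun (t : multMod E) (m : multAlg A) => adj_comp t m) mult_inner
  (@adj_compDl R A _ _ _) (@adj_compDr R A _ _ _)
  (@adj_compA R A _ _ _ _) (@adj_compZl R A _ _ _) (@adj_compZr R A _ _ _)
  (fun s => @adj_compDr R A _ _ _ (adjoint s))
  (fun k s => @adj_compZr R A _ _ _ k (adjoint s))
  (fun s => @adj_compA R A _ _ _ _ (adjoint s))
  mult_inner_star mult_inner_eq0.

End MultiplierModule.

(* The spaces of adjointable operators with their topologies.  For p in S(A),
   opnorm p on L_A(A) is the seminorm p_M(A). *)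

Section OperatorSpaces.
Context (R : realType) (A : locallyCstarType R).

Definition LA (E F : hilbertModType A) :=
  seminorm_space [set @opnorm R A E F p | p in cont_Cstar_seminormsE A].

Definition LA_alg (E : hilbertModType A) :=
  @seminorm_space R (endo_op E)
    [set @opnorm R A E E p | p in cont_Cstar_seminormsE A].

Definition multSeminorms : set (multAlg A -> \bar R) :=
  [set @opnorm R A (regmod A) (regmod A) p | p in cont_Cstar_seminormsE A].

Definition LMA (E F : hilbertModType A) :=
  seminorm_space
    [set @opnorm R (multAlg A) (multMod E) (multMod F) p | p in multSeminorms].

Definition LMA_alg (E : hilbertModType A) :=
  @seminorm_space R (endo_op (multMod E))
    [set @opnorm R (multAlg A) (multMod E) (multMod E) p | p in multSeminorms].

End OperatorSpaces.

Definition lcs_isomorphic (R : realType) (X Y : preTopologicalLmodType R[i]) :=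
  exists (f : X -> Y) (g : Y -> X),
    [/\ linear f, cancel f g, cancel g f, continuous f & continuous g].

Definition star_morphism (R : realType) (A B : starAlgType R) (f : A -> B) :=
  [/\ linear f, (forall a b, f (smul a b) = smul (f a) (f b)) &
      (forall a, f (star a) = star (f a))].

Definition locallyCstar_isomorphic (R : realType) (A B : preTopStarAlgType R) :=
  exists (f : A -> B) (g : B -> A),
    [/\ cancel f g, cancel g f, star_morphism f /\ continuous f &
        star_morphism g /\ continuous g].

(* Main.v *)
(* An operator T in L_A(E, F) acts on M(E) by s |-> T s, and x in E is
   identified with the operator a |-> x a in M(E).

   Surjectivity: let U be an adjointable operator from M(E) to M(F) and let
   s = U(x) with x in E.  Then s^* s = x^* (U^* U x) is the left
   multiplication by an element z of A, so p(s a)^2 = p(a^* z a), and if u_n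
   is an approximate unit for z then s(u_n) converges in F, to an element that
   represents s.  Hence U maps E to F.  The approximate unit consists of Cesaro
   means of powers of 1 + i z / n, so neither functional calculus nor a unit is
   needed.

   Topology: the seminorm of T equals that of its image.  This amounts to
   |s^* s|_p = |s|_p^2 for s in M(E), that is, to the fact that the norm of a
   self-adjoint operator on A is bounded by its numerical radius.  Since
   |1 + k P|^2 <= 1 + 2 M |k| + O(|k|^2) when M is the numerical radius of P,
   Cauchy's estimates for the coefficients of (1 + k P)^N give |P| <= M.  This
   avoids the Cauchy-Schwarz inequality, hence the positivity of b^* b. *)
Require Import Defs.
From mathcomp Require Import all_boot all_order all_algebra.
From mathcomp Require cyclic separable cyclotomic.
From mathcomp Require Import finmap complex.
From mathcomp Require Import all_classical all_reals all_analysis.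
From mathcomp Require Import ring lra.

Set Implicit Arguments.
Unset Strict Implicit.
Unset Printing Implicit Defensive.

Import Order.TTheory GRing.Theory Num.Theory.
Import numFieldNormedType.Exports.

Local Open Scope classical_set_scope.
Local Open Scope ring_scope.
Local Open Scope complex_scope.

Local Notation normc := ComplexField.Normc.normc.

(** * Identities in star-algebras and complex moduli *)

Section StarAlgebra.
Context (R : realType) (A : starAlgType R).
Implicit Types (a b : A) (k : R[i]).

Lemma smul0l a : smul 0 a = 0.
Proof. by rewrite -(scale0r 0) smulZl !scale0r. Qed.

Lemma smul0r a : smul a 0 = 0.
Proof. by rewrite -(scale0r 0) smulZr !scale0r. Qed.

Lemma smulNl a b : smul (- a) b = - smul a b.
Proof. by rewrite -scaleN1r smulZl scaleN1r. Qed.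

Lemma smulNr a b : smul a (- b) = - smul a b.
Proof. by rewrite -scaleN1r smulZr scaleN1r. Qed.

Lemma starN a : star (- a) = - star a.
Proof. by rewrite -scaleN1r starZ rmorphN rmorph1 scaleN1r. Qed.

Lemma smul_sumr I (r : seq I) (P : pred I) (F : I -> A) a :
  smul a (\sum_(i <- r | P i) F i) = \sum_(i <- r | P i) smul a (F i).
Proof. exact: (big_morph _ (smulDr a) (smul0r a)). Qed.

End StarAlgebra.

Section Normc.
Context (R : realType).

Lemma normc_ge0 (k : R[i]) : 0 <= normc k.
Proof. by case: k => a b; exact: sqrtr_ge0. Qed.

Lemma normc_real (x : R) : 0 <= x -> normc x%:C = x.
Proof. by move=> x0; rewrite /= expr0n addr0 sqrtr_sqr ger0_norm. Qed.

Lemma normcX (k : R[i]) n : normc (k ^+ n) = normc k ^+ n.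
Proof.
elim: n => [|n IH]; first by rewrite !expr0 ComplexField.Normc.normc1.
by rewrite !exprS ComplexField.Normc.normcM IH.
Qed.

Lemma conjcM_normc (k : R[i]) : conjc k * k = (normc k ^+ 2)%:C.
Proof.
case: k => a b; rewrite sqr_sqrtr ?addr_ge0 ?sqr_ge0//.
by apply/eqP; rewrite eq_complex /=; apply/andP; split; apply/eqP; ring.
Qed.

End Normc.

(** ['X^n - 1] is separable and splits, so it has [n] distinct roots, and a finite group of roots of
    unity is cyclic. *)
Lemma prim_root_exists (C : numClosedFieldType) n :
  (n > 0)%N -> exists z : C, n.-primitive_root z.
Proof.
pose p : {poly C} := 'X^n - 1; have [r Dp] := closed_field_poly_normal p.
move=> n_gt0; rewrite (monicP _) ?monicXnsubC // scale1r in Dp.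
have rn1 : all n.-unity_root r.
  by apply/allP=> z; rewrite -root_prod_XsubC -Dp.
have sz_r : (n < (size r).+1)%N.
  by rewrite -(size_prod_XsubC r id) -Dp size_XnsubC.
have [|z] := hasP (cyclic.has_prim_root n_gt0 rn1 _ sz_r); last by exists z.
by rewrite -separable.separable_prod_XsubC -Dp cyclotomic.separable_Xn_sub_1 //
  pnatr_eq0 -lt0n.
Qed.

(** * C*-seminorms, and two estimates on powers for the numerical radius *)

Section CstarSeminorm.
Context (R : realType) (A : starAlgType R) (p : A -> R).
Hypothesis Cp : Cstar_seminorm p.
Implicit Types (a b c : A) (k : R[i]).

Lemma seminorm_ge0 a : 0 <= p a. Proof. by have [] := Cp. Qed.
Lemma seminormD a b : p (a + b) <= p a + p b. Proof. by have [] := Cp. Qed.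
Lemma seminormZ k a : p (k *: a) = normc k * p a. Proof. by have [] := Cp. Qed.
Lemma seminormM a b : p (smul a b) <= p a * p b. Proof. by have [] := Cp. Qed.
Lemma seminorm_star_mul a : p (smul (star a) a) = p a ^+ 2. Proof. by have []
  := Cp. Qed.

Lemma seminorm0 : p 0 = 0.
Proof. by rewrite -(scale0r 0) seminormZ ComplexField.Normc.normc0 mul0r. Qed.

Lemma seminormZr (x : R) a : 0 <= x -> p (x%:C *: a) = x * p a.
Proof. by move=> x0; rewrite seminormZ normc_real. Qed.

Lemma seminormN a : p (- a) = p a.
Proof. by rewrite -scaleN1r seminormZ /= oppr0 expr0n addr0 sqrtr_sqr normrN1
  mul1r. Qed.

Lemma seminormB a b : p (a - b) <= p a + p b.
Proof. by rewrite -(seminormN b) seminormD. Qed.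

Lemma seminorm_sum I (r : seq I) (P : pred I) (F : I -> A) :
  p (\sum_(i <- r | P i) F i) <= \sum_(i <- r | P i) p (F i).
Proof.
elim/big_rec2: _ => [|i y x _ xy]; first by rewrite seminorm0.
by rewrite (le_trans (seminormD _ _))// lerD2l.
Qed.

(** The C*-identity and submultiplicativity give [p b ^+ 2 <= p (star b) * p b]; cancel [p b], then
    apply the result to [star a] as well. *)
Lemma seminorm_star a : p (star a) = p a.
Proof.
suff H b : p b <= p (star b) by apply/le_anti; rewrite H -{2}(starK a) H.
have := seminormM (star b) b; rewrite seminorm_star_mul.
have := seminorm_ge0 b; rewrite le_eqVlt => /orP[/eqP<-|b0];
  first by rewrite seminorm_ge0.
by rewrite expr2 ler_pM2r.
Qed.

End CstarSeminorm.

(* Cauchy's estimate for a polynomial with vector coefficients, obtained by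
   averaging over the m-th roots of unity. *)
Lemma cauchy_coef_bound (R : realType) (V : lmodType R[i]) (p : V -> R)
  (m : nat) (v : 'I_m -> V) (B : R) (j : 'I_m) :
  (forall x y, p (x + y) <= p x + p y) ->
  (forall (k : R[i]) x, p (k *: x) = normc k * p x) ->
  (forall k : R[i], normc k = 1 -> p (\sum_(i < m) k ^+ i *: v i) <= B) ->
  p (v j) <= B.
Proof.
move=> pD pZ pB.
have m0 : (0 < m)%N by case: m j {v pB} => [[]//|].
have [w pw] := prim_root_exists R[i] m0.
have w1 : normc w = 1.
  apply/eqP; rewrite -(@pexpr_eq1 _ _ m)// ?normc_ge0// -normcX.
  by rewrite (prim_expr_order pw) ComplexField.Normc.normc1.
have w0 : w != 0.
  by apply/eqP => w0; move: w1; rewrite w0 ComplexField.Normc.normc0 =>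
    /esym/eqP; rewrite oner_eq0.
have p0 : p 0 = 0 by rewrite -(scale0r 0) pZ ComplexField.Normc.normc0 mul0r.
have wX i : (w ^+ i) ^+ m = 1.
  by rewrite -exprM mulnC exprM (prim_expr_order pw) expr1n.
have sumE : \sum_(l < m) (w ^+ l) ^- j *: (\sum_(i < m) (w ^+ l) ^+ i *: v i) =
    m%:R *: v j.
  under eq_bigr do rewrite scaler_sumr.
  rewrite exchange_big (bigD1 j)//= [X in _ + X]big1 ?addr0; last first.
    move=> i ij; under eq_bigr do rewrite scalerA.
    rewrite -scaler_suml.
    suff -> : \sum_(l < m) (w ^+ l) ^- j * (w ^+ l) ^+ i = 0 by rewrite scale0r.
    under eq_bigr => l _ do rewrite -!exprM !(mulnC l) !exprM -exprVn -exprMn.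
    (* [w ^+ i / w ^+ j] is an [m]-th root of unity other than 1, so its powers sum to zero. *)
    have: (w ^+ i / w ^+ j) ^+ m - 1 = 0.
      by rewrite expr_div_n !wX divr1 subrr.
    move/eqP; rewrite subrX1 mulf_eq0 => /orP[|/eqP].
      rewrite subr_eq0 -(inj_eq (mulIf (expf_neq0 j w0))) mul1r mulfVK
        ?expf_neq0//.
      by rewrite (eq_prim_root_expr pw) !modn_small// => /eqP/ord_inj/eqP;
        rewrite (negbTE ij).
    by move=> H; rewrite -[RHS]H; apply: eq_bigr => l _; rewrite [in RHS]mulrC.
  under eq_bigr => l _ do rewrite scalerA mulVf ?expf_neq0// scale1r.
  by rewrite sumr_const card_ord scaler_nat.
have mE : normc (m%:R : R[i]) = m%:R.
  by rewrite -(rmorph_nat (real_complex R)) normc_real.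
have : p (m%:R *: v j) <= \sum_(l < m) B.
  rewrite -sumE.
  elim/big_rec2: _ => [|l y x _ xy]; first by rewrite p0.
  rewrite (le_trans (pD _ _))// lerD// pZ ComplexField.Normc.normcV !normcX w1.
  by rewrite !expr1n invr1 mul1r pB// normcX w1 expr1n.
by rewrite pZ mE sumr_const card_ord -[B *+ m]mulr_natl ler_pM2l ?ltr0n.
Qed.

Lemma bernoulli_ge (R : realFieldType) (d : R) n : 0 <= d ->
  1 + n%:R * d <= (1 + d) ^+ n.
Proof.
move=> d0; elim: n => [|n IH]; first by rewrite mul0r addr0 expr0.
rewrite exprS -[n.+1]addn1 natrD.
have n0 : 0 <= n%:R * d * d by rewrite !mulr_ge0.
have := ler_wpM2l (_ : 0 <= 1 + d) IH.
by move=> /(_ (addr_ge0 ler01 d0)); apply: le_trans; nra.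
Qed.

(** A linear factor cannot compensate exponential growth: if [x / y = 1 + d] with [d > 0], the
    squared Bernoulli inequality at exponent [2n] gives at least [(1 + n d)^2], which exceeds
    [2n + 1] once [n d^2 > 2]. *)
Lemma le_of_exprn_le (R : realType) (x y : R) : 0 <= x -> 0 < y ->
  (forall n, x ^+ n <= n.+1%:R * y ^+ n) -> x <= y.
Proof.
move=> x0 y0 H; rewrite leNgt; apply/negP => yx.
pose d := x / y - 1.
have d0 : 0 < d by rewrite subr_gt0 ltr_pdivlMr// mul1r.
have xE : x / y = 1 + d by rewrite /d; ring.
have Hd n : (1 + d) ^+ n <= n.+1%:R.
  by rewrite -xE expr_div_n ler_pdivrMr ?exprn_gt0.
have [n nd] : exists n : nat, 2 / d ^+ 2 < n%:R.
  by exists (Num.bound (2 / d ^+ 2)); exact: archi_boundP (divr_ge0 _ (sqr_ge0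
    _)).
have := Hd (n * 2)%N; rewrite exprM.
have Bn := bernoulli_ge n (ltW d0).
have n0 : 0 <= n%:R :> R by [].
have : (1 + n%:R * d) ^+ 2 <= ((1 + d) ^+ n) ^+ 2.
  by rewrite ler_pXn2r// nnegrE ?exprn_ge0//; nra.
move=> /le_trans h/h{h}; rewrite -[(n * 2).+1]addn1 natrD natrM.
move: nd; rewrite ltr_pdivrMr ?exprn_gt0// => nd.
have n1 : 0 < n%:R :> R.
  by rewrite lt_neqAle n0 andbT; apply/eqP => n1; move: nd; rewrite -n1 mul0r;
    lra.
by apply/negP; rewrite -ltNge; nra.
Qed.

(** * Norm and numerical radius of a symmetric operator *)

Section SymmetricOperator.
Context (R : realType) (A : starAlgType R) (p : A -> R) (P : A -> A) (M : R).
Hypothesis Cp : Cstar_seminorm p.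
Hypothesis M0 : 0 <= M.
Hypothesis Plin : linear P.
Hypothesis Psym : forall a b, smul (star (P a)) b = smul (star a) (P b).
Hypothesis Pform : forall a, p (smul (star a) (P a)) <= M * p a ^+ 2.
Implicit Types (a b : A) (k : R[i]).

Let PD a b : P (a + b) = P a + P b.
Proof. by have := Plin 1 a b; rewrite !scale1r. Qed.

Let P0 : P 0 = 0.
Proof. by apply: (addrI (P 0)); rewrite -PD !addr0. Qed.

Let PZ k a : P (k *: a) = k *: P a.
Proof. by have := Plin k a 0; rewrite P0 !addr0. Qed.

Let PN a : P (- a) = - P a.
Proof. by rewrite -scaleN1r PZ scaleN1r. Qed.

(** A crude bound by polarization: with [b = t P a], the values of the form at [a + b] and [a - b]
    differ by [4 t] times [star (P a)] times [P a], whose seminorm is [p (P a) ^+ 2]. *)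
Let Lbound a : p (P a) <= 2 * M * p a.
Proof.
have x0 : 0 <= p (P a) by exact: seminorm_ge0.
have y0 : 0 <= p a by exact: seminorm_ge0.
have [x xE] : {x | p (P a) = x} by exists (p (P a)).
have [y yE] : {y | p a = y} by exists (p a).
rewrite xE in x0 *; rewrite yE in y0 *.
have [->|xN0] := eqVneq x 0; first by rewrite !mulr_ge0.
have {}x0 : 0 < x by rewrite lt_neqAle eq_sym xN0.
have polar (t : R) : 0 <= t -> 4 * t * x ^+ 2 <= 2 * M * (y + t * x) ^+ 2.
  move=> t0; pose b := t%:C *: P a.
  have xb : p b = t * x by rewrite /b seminormZr// xE.
  have ab : smul (star a) (P b) = t%:C *: smul (star (P a)) (P a).
    by rewrite -Psym /b smulZr.
  have ba : smul (star b) (P a) = t%:C *: smul (star (P a)) (P a).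
    by rewrite /b starZ smulZl conjc_real.
  have E : smul (star (a + b)) (P (a + b)) - smul (star (a - b)) (P (a - b)) =
      (4 * t)%:C *: smul (star (P a)) (P a).
    rewrite !PD PN !starD starN !smulDl !smulDr !smulNl !smulNr ab ba.
    set u := smul _ _; set v := smul (star b) _; set w := t%:C *: _.
    rewrite rmorphM -scalerA -/w rmorph_nat scaler_nat.
    rewrite opprK opprD addrACA opprB opprD opprK [u + w]addrC.
    have wK z : w + z + (w - z) = w *+ 2 by rewrite addrACA subrr addr0.
    by rewrite !wK -mulrnDr.
  have : p ((4 * t)%:C *: smul (star (P a)) (P a)) <=
      M * p (a + b) ^+ 2 + M * p (a - b) ^+ 2.
    by rewrite -E (le_trans (seminormB Cp _ _))// lerD.
  rewrite seminormZr// ?mulr_ge0// seminorm_star_mul// xE => /le_trans; apply.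
  have tx0 : 0 <= y + t * x by rewrite addr_ge0// mulr_ge0// ltW.
  have hD : p (a + b) ^+ 2 <= (y + t * x) ^+ 2.
    by rewrite ler_pXn2r// ?nnegrE ?(seminorm_ge0 Cp)// -xb -yE seminormD.
  have hB : p (a - b) ^+ 2 <= (y + t * x) ^+ 2.
    by rewrite ler_pXn2r// ?nnegrE ?(seminorm_ge0 Cp)// -xb -yE seminormB.
  by rewrite -mulrA mulr_natl mulr2n lerD// ler_wpM2l.
apply/ler_addgt0Pr => e e0.
pose d := e / (2 * M + 1).
have M1 : 0 < 2 * M + 1.
  rewrite ltr_wpDl// ?mulr_ge0//.
have d0 : 0 < d by rewrite divr_gt0.
(* This makes [t * x = y + d], close to the balanced choice [t * x = y]; the margin [d] keeps the
   common factor [4 * (y + d)] positive even when [p a = 0]. *)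
have := polar ((y + d) / x) (divr_ge0 _ (ltW x0)).
move=> /(_ (addr_ge0 y0 (ltW d0))).
rewrite (_ : 4 * _ * _ = 4 * (y + d) * x); last by field; exact/lt0r_neq0.
rewrite mulfVK// => h.
have {}h : x <= 2 * M * (y + d).
  rewrite -(@ler_pM2l _ (4 * (y + d))); last by lra.
  apply: (le_trans h).
  have : (y + (y + d)) ^+ 2 <= (2 * (y + d)) ^+ 2.
    by rewrite ler_pXn2r// ?nnegrE; lra.
  by move=> /(ler_wpM2l M0) h'; lra.
have : d * (2 * M + 1) = e by rewrite mulfVK// lt0r_neq0.
by nra.
Qed.

Let step k a := a + k *: P a.

(** Bounds the square of the norm of [1 + k P] for [normc k = r]: the cross terms are controlled by
    the numerical radius [M], the quadratic term by the crude bound [2 * M]. *)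
Let E r := 1 + 2 * r * M + r ^+ 2 * (2 * M) ^+ 2.

Let E_ge0 r : 0 <= r -> 1 <= E r.
Proof.
move=> r0; rewrite /E -addrA lerDl addr_ge0// ?mulr_ge0 ?sqr_ge0//.
Qed.

Let step_bound k a : p (step k a) ^+ 2 <= E (normc k) * p a ^+ 2.
Proof.
rewrite -(seminorm_star_mul Cp) /step starD starZ !smulDl !smulDr !smulZl
  !smulZr scalerA.
rewrite [smul (star (P a)) a]Psym conjcM_normc.
have nk := normc_ge0 k.
have pa := seminorm_ge0 Cp a; have pPa := seminorm_ge0 Cp (P a).
have nkJ : normc (conjc k) = normc k by case: (k) => x y /=; rewrite sqrrN.
rewrite (le_trans (seminormD Cp _ _))//.
apply: (le_trans (lerD (seminormD Cp _ _) (seminormD Cp _ _))).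
rewrite !(seminorm_star_mul Cp) seminormZr ?sqr_ge0// !seminormZ// nkJ
  (seminorm_star_mul Cp).
have h1 := ler_wpM2l nk (Pform a).
have h2 : p (P a) ^+ 2 <= (2 * M * p a) ^+ 2.
  by rewrite ler_pXn2r ?nnegrE ?mulr_ge0.
by have h3 := ler_wpM2l (sqr_ge0 (normc k)) h2; rewrite /E; lra.
Qed.

Let step_bound_iter k N a : p (iter N (step k) a) <= Num.sqrt (E (normc k)) ^+
  N * p a.
Proof.
have E0 : 0 <= E (normc k) by rewrite (le_trans _ (E_ge0 _))// normc_ge0.
elim: N => [|N IH]; first by rewrite expr0 mul1r.
rewrite iterS exprS -mulrA (@le_trans _ _ (Num.sqrt (E (normc k)) * p (iter N
  (step k) a)))//.
  have := step_bound k (iter N (step k) a).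
  rewrite -{1}[E _]sqr_sqrtr// -exprMn ler_pXn2r// nnegrE ?mulr_ge0
    ?sqrtr_ge0//; exact: seminorm_ge0.
by rewrite ler_wpM2l ?sqrtr_ge0.
Qed.

Let step_binomial k N a :
  iter N (step k) a = \sum_(i < N.+1) k ^+ i *: ('C(N, i)%:R *: iter i P a).
Proof.
have Psum n (F : 'I_n -> A) : P (\sum_(i < n) F i) = \sum_(i < n) P (F i).
  exact: (big_morph _ PD P0).
elim: N => [|N IH]; first by rewrite big_ord1 /= expr0 !scale1r.
rewrite iterS {}IH /step Psum scaler_sumr.
rewrite [X in X + _ = _]big_ord_recl [RHS]big_ord_recl.
rewrite !bin0 -addrA; congr (_ + _).
have -> : \sum_(i < N) k ^+ bump 0 i *: ('C(N, bump 0 i)%:R *: iter (bump 0 i)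
  P a) =
  \sum_(i < N.+1) k ^+ i.+1 *: ('C(N, i.+1)%:R *: iter i.+1 P a).
  by rewrite big_ord_recr /= bin_small// scale0r scaler0 addr0.
rewrite -big_split; apply: eq_bigr => i _ /=.
rewrite !PZ scalerA -exprS -scalerDr -scalerDl -natrD /bump add1n binS.
by rewrite addnC.
Qed.

(** Cauchy's estimate on the circle of radius [r] for the polynomial [(1 + k P)^N a]. The powers of
    [r] are absorbed into the coefficients [v], so that [k] runs over the unit circle. *)
Let coef_bound (r : R) N j a : 0 <= r -> (j <= N)%N ->
  'C(N, j)%:R * r ^+ j * p (iter j P a) <= Num.sqrt (E r) ^+ N * p a.
Proof.
move=> r0 jN; have jN1 : (j < N.+1)%N by [].
pose v (i : 'I_N.+1) := r%:C ^+ i *: ('C(N, i)%:R *: iter i P a).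
have := @cauchy_coef_bound R A p N.+1 v (Num.sqrt (E r) ^+ N * p a) (Ordinal
  jN1)
  (seminormD Cp) (seminormZ Cp).
rewrite /v /= !(seminormZ Cp) normcX normc_real//.
rewrite -(rmorph_nat (real_complex R)) normc_real// mulrA [_ * r ^+ j]mulrC.
apply=> k k1; under eq_bigr do rewrite scalerA -exprMn.
have kr : normc (k * r%:C) = r by rewrite ComplexField.Normc.normcM k1 mul1r
  normc_real.
by rewrite -step_binomial -{2}kr step_bound_iter.
Qed.

(** By the C*-identity the left side is a form value in which symmetry moves one factor [P] to the
    right. Hence the ratios of consecutive seminorms of [iter n P a] do not decrease. *)
Let log_convex n a : p (iter n.+1 P a) ^+ 2 <= p (iter n P a) * p (iter n.+2 P
  a).
Proof.
rewrite -(seminorm_star_mul Cp) [X in smul (star X)]iterS Psym.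
by rewrite (le_trans (seminormM Cp _ _))// seminorm_star.
Qed.

Let iter_ge a n : 0 < p (P a) ->
  (p (P a) / p a) ^+ n * p a <= p (iter n P a).
Proof.
move=> Pa0.
have a0 : 0 < p a.
  have := seminorm_ge0 Cp a; rewrite le_eqVlt => /orP[/eqP pa0|//].
  by have := Lbound a; rewrite -pa0 mulr0 leNgt Pa0.
set th := _ / _.
have th0 : 0 < th by rewrite divr_gt0.
have iter_gt0 : forall m, 0 < p (iter m P a) /\ th * p (iter m P a) <= p (iter
  m.+1 P a).
  elim=> [|m [m0 IH]]; first by split => //=; rewrite mulfVK// lt0r_neq0.
  have m1 : 0 < p (iter m.+1 P a) by rewrite (lt_le_trans _ IH)// mulr_gt0.
  split => //; rewrite -(ler_pM2l m0) (le_trans _ (log_convex m a))// expr2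
    mulrA.
  by rewrite ler_pM2r// mulrC.
elim: n => [|n IH]; first by rewrite expr0 mul1r.
rewrite exprS -mulrA (le_trans _ (iter_gt0 n).2)// ler_pM2l//.
Qed.

(* The binomial coefficients of (1 + kP)^N are bounded through
   |1 + kP|^2 <= 1 + 2rM + O(r^2) for |k| = r; summing these bounds gives
   (1 + r |P|)^N <= (N + 1) (1 + 2rM + O(r^2))^(N/2). *)
Lemma norm_le_numerical_radius a : p (P a) <= M * p a.
Proof.
have := seminorm_ge0 Cp (P a); rewrite le_eqVlt => /orP[/eqP<-|Pa0].
  by rewrite mulr_ge0 ?(seminorm_ge0 Cp).
have a0 : 0 < p a.
  have := seminorm_ge0 Cp a; rewrite le_eqVlt => /orP[/eqP pa0|//].
  by have := Lbound a; rewrite -pa0 mulr0 leNgt Pa0.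
have iterP n := iter_ge n Pa0.
rewrite -ler_pdivrMr//; set th := _ / _ in iterP *.
have th0 : 0 < th by rewrite divr_gt0.
have H (r : R) : 0 < r -> 1 + r * th <= Num.sqrt (E r).
  move=> r0; have r0' := ltW r0.
  have E1 := E_ge0 r0'.
  have rth : 0 <= r * th by rewrite mulr_ge0 ?ltW.
  apply: le_of_exprn_le => [||N]; first by rewrite addr_ge0.
    by rewrite sqrtr_gt0 (lt_le_trans _ E1).
  rewrite exprDn.
  rewrite (_ : N.+1%:R * _ = \sum_(i < N.+1) Num.sqrt (E r) ^+ N); last first.
    by rewrite sumr_const card_ord mulr_natl.
  apply: ler_sum => i _; rewrite expr1n mul1r exprMn -mulr_natl.
  rewrite -(ler_pM2r a0) (le_trans _ (@coef_bound r N i a r0' (ltn_ord i)))//.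
  by rewrite -!mulrA ler_wpM2l// ler_wpM2l ?exprn_ge0.
apply/ler_addgt0Pr => e e0.
(* Squaring [H] and dropping [(r * th) ^+ 2] leaves [th <= M + 2 r M^2], so [r] is chosen with
   [2 r M^2 <= e]. *)
pose r := e / (2 * M ^+ 2 + 1).
have M2 := sqr_ge0 M.
have M1 : 0 < 2 * M ^+ 2 + 1 by lra.
have r0 : 0 < r by rewrite divr_gt0.
have := H r r0.
have er0 := E_ge0 (ltW r0).
have E0 : 0 <= E r by lra.
rewrite -(@ler_pXn2r _ 2)// ?nnegrE ?sqrtr_ge0//; last first.
  by rewrite addr_ge0// mulr_ge0// ltW.
rewrite sqr_sqrtr// /E => h.
have re : r * (2 * M ^+ 2 + 1) = e by rewrite mulfVK// lt0r_neq0.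
have {}h : r * th <= r * (M + r * (2 * M ^+ 2)).
  by have h2 := sqr_ge0 (r * th); nra.
move: h; rewrite ler_pM2l// => /le_trans; apply.
by rewrite lerD2l -re; nra.
Qed.

End SymmetricOperator.

(** * An approximate unit for a self-adjoint element *)

Section ApproximateUnit.
Context (R : realType) (A : starAlgType R) (z : A).
Hypothesis z_sa : star z = z.

Section UnitPower.
Context (k : R[i]).

(* In the unitization, [unit_power n = (1 + k z) ^ n - 1]. *)
Definition unit_power n : A := iter n (fun v => v + k *: (z + smul v z)) 0.

Lemma unit_powerC n : smul z (unit_power n) = smul (unit_power n) z.
Proof.
elim: n => [|n IH]; first by rewrite smul0l smul0r.
by rewrite /unit_power iterS -/(unit_power n) smulDr smulDl smulZr smulZl
  smulDr smulDl smulA IH.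
Qed.

(** The geometric sum for [1 + k z]: the mean of [n] terms [z (1 + k z)^j] is therefore
    [unit_power n] divided by [n k]. *)
Lemma unit_power_sum n :
  k *: (\sum_(j < n) (z + smul z (unit_power j))) = unit_power n.
Proof.
elim: n => [|n IH]; first by rewrite big_ord0 scaler0.
by rewrite big_ord_recr /= scalerDr IH unit_powerC.
Qed.

Context (p : A -> R).
Hypothesis Cp : Cstar_seminorm p.
Hypothesis kJ : conjc k = - k.

(** For imaginary [k] and self-adjoint [z], [1 + k z] times its star is [1 + |k|^2 z^2]. The terms
    linear in [k] cancel, so the growth per step is only of order [|k|^2]. *)
Let step_bound c :
  p (c + k *: smul c z) ^+ 2 <= (1 + normc k ^+ 2 * p z ^+ 2) * p c ^+ 2.
Proof.
rewrite -(seminorm_star Cp) -(seminorm_star_mul Cp) starK starD starZ starM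
  z_sa kJ.
rewrite !smulDl !smulDr !smulZr !smulZl !smulA !scaleNr addrA addrNK.
rewrite scalerA -scaleNr -mulNr -kJ conjcM_normc (le_trans (seminormD Cp _
  _))//.
rewrite seminormZr ?sqr_ge0// mulrDl mul1r lerD//.
  by rewrite -{1}(starK c) (seminorm_star_mul Cp) (seminorm_star Cp).
rewrite -mulrA ler_wpM2l ?sqr_ge0// -smulA (le_trans (seminormM Cp _ _))//.
have h1 := seminormM Cp c z; have := seminormM Cp z (star c).
rewrite (seminorm_star Cp) => h2.
rewrite (_ : p z ^+ 2 * _ = (p c * p z) * (p z * p c)); last by ring.
by rewrite ler_pM// (seminorm_ge0 Cp).
Qed.

Lemma unit_power_bound c n :
  p (c + smul c (unit_power n)) ^+ 2 <= (1 + normc k ^+ 2 * p z ^+ 2) ^+ n * p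
    c ^+ 2.
Proof.
elim: n => [|n IH]; first by rewrite smul0r addr0 expr0 mul1r.
rewrite /unit_power iterS -/(unit_power n) smulDr smulZr smulDr smulA addrA.
rewrite -smulDl (le_trans (step_bound _))// [_ ^+ n.+1]exprS -mulrA ler_wpM2l//.
by rewrite addr_ge0// mulr_ge0// sqr_ge0.
Qed.

End UnitPower.

(* The averages of the powers of 1 + i z / (N + 1) are bounded by the growth
   estimate above, and their products with z telescope. *)
Lemma approximate_unit : exists u : nat -> A, forall p, Cstar_seminorm p ->
  exists2 C, 0 <= C & forall N, (forall c, p (c - smul c (u N)) <= C * p c) /\
    p (z - smul z (u N)) <= C / N.+1%:R.
Proof.
(* With [|k| = 1 / (N + 1)], all powers up to [(N + 1)^2] stay below [expR (p z ^+ 2)] uniformly in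
   [N], while the telescoped mean retains the factor [1 / (m |k|) = 1 / (N + 1)]. *)
pose m N := (N.+1 ^ 2)%N.
pose k N : R[i] := 0 +i* N.+1%:R^-1.
have kJ N : conjc (k N) = - k N by apply/eqP; rewrite eq_complex /= oppr0 !eqxx.
have kn N : normc (k N) = N.+1%:R^-1.
  by rewrite /k /= expr0n add0r sqrtr_sqr ger0_norm// invr_ge0.
pose w N : R[i] := ((m N)%:R^-1)%:C.
have m_neq0 N : (m N)%:R != 0 :> R by rewrite pnatr_eq0 expn_eq0.
have avg N (x : A) : w N *: (\sum_(j < m N) x) = x.
  rewrite sumr_const card_ord -scaler_nat scalerA -(rmorph_nat (real_complex
    R)).
  by rewrite -rmorphM mulVf// scale1r.
pose u N : A := - (w N *: \sum_(j < m N) unit_power (k N) j).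
have cu c N : c - smul c (u N) =
    w N *: \sum_(j < m N) (c + smul c (unit_power (k N) j)).
  by rewrite big_split scalerDr avg /u smulNr smulZr smul_sumr opprK.
exists u => p Cp; pose G := expR (p z ^+ 2).
have G1 : 1 <= G by rewrite -expR0 ler_expR sqr_ge0.
have G0 : 0 <= G by lra.
have pw N j c : (j <= m N)%N ->
    p (c + smul c (unit_power (k N) j)) <= G * p c.
  move=> jm; rewrite -(@ler_pXn2r _ 2)// ?nnegrE ?mulr_ge0 ?(seminorm_ge0 Cp)//.
  rewrite (le_trans (unit_power_bound Cp (kJ N) c j))// exprMn ler_wpM2r
    ?sqr_ge0//.
  rewrite (@le_trans _ _ G)//; last by rewrite expr2 ler_peMl.
  rewrite kn; set x := p z ^+ 2.
  have x0 : 0 <= x by exact: sqr_ge0.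
  have y0 : 0 <= N.+1%:R^-1 ^+ 2 * x by rewrite mulr_ge0// sqr_ge0.
  rewrite (@le_trans _ _ ((1 + N.+1%:R^-1 ^+ 2 * x) ^+ m N))//.
    by rewrite ler_weXn2l ?lerDl.
  rewrite (@le_trans _ _ (expR (N.+1%:R^-1 ^+ 2 * x) ^+ m N))//.
    by rewrite ler_pXn2r ?expR_ge1Dx ?nnegrE ?expR_ge0// ?expn_gt0// addr_ge0.
  by rewrite -expRM_natl mulrA natrX -exprMn divff ?expr1n ?mul1r// pnatr_eq0.
exists (G + 1) => [|N]; first by lra.
split=> [c|].
  rewrite cu seminormZr ?invr_ge0// ler_pdivrMl ?ltr0n ?expn_gt0//.
  rewrite (le_trans (seminorm_sum Cp _ _ _))//.
  rewrite (@le_trans _ _ (\sum_(j < m N) ((G + 1) * p c)))//.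
    by apply: ler_sum => j _; rewrite (le_trans (pw _ _ _ (ltnW (ltn_ord
      j))))// ler_wpM2r ?(seminorm_ge0 Cp)// lerDl.
  by rewrite sumr_const card_ord mulr_natl.
have k0 : k N != 0 by rewrite eq_complex /= negb_and invr_eq0 pnatr_eq0 orbT.
have -> : z - smul z (u N) = (w N / k N) *: unit_power (k N) (m N).
  by rewrite cu -unit_power_sum !scalerA mulfVK.
set v := unit_power _ _.
(* Write [star v] times [v] as the value of [c + c v] at [c = star v], minus [star v]; then [pw]
   gives [p v ^+ 2 <= (G + 1) * p v]. *)
have pv : p v <= G + 1.
  have := seminorm_ge0 Cp v; rewrite le_eqVlt => /orP[/eqP<-|v0]; first by lra.
  rewrite -(ler_pM2r v0) -expr2 -(seminorm_star_mul Cp).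
  rewrite -[smul _ _](addKr (star v)) addrC (le_trans (seminormB Cp _ _))//.
  by have := pw N (m N) (star v) (leqnn _); rewrite (seminorm_star Cp) -/v; lra.
rewrite (seminormZ Cp) ComplexField.Normc.normcM ComplexField.Normc.normcV kn
  invrK.
rewrite /w normc_real ?invr_ge0// (_ : (m N)%:R^-1 * _ = N.+1%:R^-1);
  last first.
  by rewrite natrX expr2 invfM mulfVK// pnatr_eq0.
by rewrite mulrC ler_wpM2r// invr_ge0.
Qed.

End ApproximateUnit.

(** * Uniformities given by seminorms, and Hilbert modules *)

Section SeminormEntourage.
Context (R : realType).

Lemma seminorm_entourage1 (V : zmodType) (Q : set (V -> \bar R)) q (e : R) :
  Q q -> 0 < e -> seminorm_entourage Q [set xy | (q (xy.1 - xy.2)%R < e%:E)%E].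
Proof.
move=> Qq e0; exists [set q], e; split=> //; first by move=> _ ->.
by move=> x y; apply.
Qed.

Lemma near_seminorm_entourage (V : zmodType) (Q : set (V -> \bar R)) I
    (G : set_system I) (FG : Filter G) (f g : I -> V) U :
  (forall q (e : R), Q q -> 0 < e -> \forall i \near G, (q (f i - g i)%R <
    e%:E)%E) ->
  seminorm_entourage Q U -> \forall i \near G, U (f i, g i).
Proof.
move=> H [P [e [/finite_fsetP[X PX] PQ e0 PU]]].
have HX q : P q -> G [set i | (q (f i - g i)%R < e%:E)%E].
  by move=> /PQ Qq; exact: H.
rewrite PX in HX; have := filter_bigI FG HX; rewrite -PX.
by apply: filterS => i Hi; exact: PU.
Qed.

End SeminormEntourage.

Lemma hnormE (R : realType) (A : starAlgType R) (E : innerModType A) (p : A ->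
  R)
  (x : E) : hnorm (fun a => (p a)%:E) x = (Num.sqrt (p (inner x x)))%:E.
Proof. by []. Qed.

Section InnerModule.
Context (R : realType) (A : starAlgType R) (E : innerModType A).
Implicit Types (x y : E) (a b : A).

Lemma inner_ractl x y a : inner (ract x a) y = smul (star a) (inner x y).
Proof. by rewrite -inner_star inner_ract starM inner_star. Qed.

Lemma ractNl x a : ract (- x) a = - ract x a.
Proof. by rewrite -scaleN1r ractZl scaleN1r. Qed.

End InnerModule.

Section HilbertModule.
Context (R : realType) (A : locallyCstarType R).
Implicit Types (a b : A) (p : A -> R).

Lemma hnorm_ract (E : innerModType A) p (x : E) a : Cstar_seminorm p ->
  Num.sqrt (p (inner (ract x a) (ract x a))) <= Num.sqrt (p (inner x x)) * p a.
Proof.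
move=> Cp; have pa := seminorm_ge0 Cp a.
rewrite -[X in _ * X]ger0_norm// -sqrtr_sqr -sqrtrM ?(seminorm_ge0 Cp)//.
apply: ler_wsqrtr; rewrite inner_ract inner_ractl.
apply: (le_trans (seminormM Cp _ _)); rewrite expr2 mulrA ler_wpM2r//.
by rewrite mulrC (le_trans (seminormM Cp _ _))// (seminorm_star Cp).
Qed.

(** Nondegeneracy of the product. Taking [a = x b] gives [x b = 0] for all [b]; then [b = star x]
    gives [star x = 0], both times because [star y] times [y] vanishes only for [y = 0]. *)
Lemma smul_eq0 (x : A) : (forall a b, smul (star a) (smul x b) = 0) -> x = 0.
Proof.
have eq0 (y : A) : smul (star y) y = 0 -> y = 0 by move/(@inner_eq0 R A (regmod
  A)).
move=> H; have xb b : smul x b = 0 by apply: eq0; exact: H.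
have: star x = 0 by apply: eq0; rewrite starK xb.
by move/(congr1 star); rewrite starK -(scale0r 0) starZ conjc0 !scale0r.
Qed.

(** Separation is inherited from [A]: every seminorm of the inner square of [x - y] is below every
    positive [e]. *)
Lemma hilbert_eq (E : hilbertModType A) (x y : E) :
  (forall U, entourage U -> U (x, y)) -> x = y.
Proof.
move=> H; apply/eqP; rewrite -subr_eq0; apply/eqP/(@inner_eq0 R A).
apply: cont_Cstar_seminorms_eq0 => p Sp; have [Cp _] := Sp.
apply/le_anti; rewrite (seminorm_ge0 Cp) andbT.
apply/ler_addgt0Pr => e e0; rewrite add0r.
have : seminorm_entourage [set @hnorm R A E p | p in cont_Cstar_seminormsE A]
    [set xy : E * E | (hnorm (fun a => (p a)%:E) (xy.1 - xy.2)%R < (Num.sqrt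
      e)%:E)%E].
  apply: seminorm_entourage1; last by rewrite sqrtr_gt0.
  by exists (fun a => (p a)%:E) => //; exists p.
by rewrite -hnormsP => /H /=; rewrite hnormE lte_fin ltr_sqrt// => /ltW.
Qed.

End HilbertModule.

Lemma near_natSinv_mul (R : realType) (K e : R) : 0 <= K -> 0 < e ->
  \forall N \near \oo, K * N.+1%:R^-1 < e.
Proof.
move=> K0 e0; have K1 : 0 < K + 1 by rewrite ltr_wpDl.
have := near_infty_natSinv_lt (PosNum (divr_gt0 e0 K1)).
apply: filterS => N /=; rewrite ltr_pdivlMr// => h.
have := invr_ge0 (N.+1%:R : R); rewrite ler0n => n0.
by rewrite (le_lt_trans _ h)// mulrC ler_wpM2l// lerDl.
Qed.

Lemma sqrtr_lt (R : rcfType) (x e : R) : 0 < e -> x < e ^+ 2 -> Num.sqrt x < e.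
Proof.
by move=> e0 xe; rewrite -[e]gtr0_norm// -sqrtr_sqr ltr_sqrt// exprn_gt0.
Qed.

Lemma innerNN (R : realType) (A : starAlgType R) (E : innerModType A) (x y : E) :
  inner (- x) (- y) = inner x y :> A.
Proof.
by rewrite -scaleN1r -(scaleN1r y) innerZr innerZl scalerA rmorphN rmorph1
  mulrNN mulr1 scale1r.
Qed.

(** * The embedding of a module into its multiplier module *)

Section Embedding.
Context (R : realType) (A : locallyCstarType R).

Section InnerMod.
Context (E : innerModType A).

Lemma ract_adjointable (x : E) :
  (fun a : regmod A => ract x a) \in @adjointable R A (regmod A) E.
Proof.
apply/asboolP; split.
  by split=> [k a b|a b] /=; [rewrite ractDr ractZr|exact: ractA].
exists (fun y => inner x y : regmod A).
  by split=> [k a b|a b] /=; [rewrite innerDr innerZr|exact: inner_ract].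
by move=> a y; exact: inner_ractl.
Qed.

Definition embed (x : E) : adj_op (regmod A) E := AdjOp (ract_adjointable x).

Lemma embedE x a : embed x a = ract x a. Proof. by []. Qed.

Lemma adjoint_embedE x y : adjoint (embed x) y = inner x y.
Proof.
by apply: (@inner_extr R A (regmod A)) => a; rewrite -adjointP embedE
  inner_ractl.
Qed.

Lemma adj_op_smul (F : innerModType A) (s : adj_op (regmod A) F) (a b : A) :
  s (smul a b) = ract (s a) b.
Proof. exact: (adj_op_morph s).2 a b. Qed.

Lemma adj_op_B (F G : innerModType A) (s : adj_op F G) a b : s (a - b) = s a -
  s b.
Proof. by rewrite -scaleN1r adj_op_D adj_op_Z scaleN1r. Qed.

Lemma ract_eq0 (x : E) : (forall a, ract x a = 0) -> x = 0.
Proof.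
move=> x0; apply/(@inner_eq0 R A); apply: (smul_eq0 (x := inner x x)) => a b.
by rewrite -inner_ract x0 inner0r smul0r.
Qed.

Lemma embed_inj : injective embed.
Proof.
move=> x y xy; apply/eqP; rewrite -subr_eq0; apply/eqP/ract_eq0 => a.
by rewrite ractDl ractNl -!embedE xy subrr.
Qed.

End InnerMod.

(* [eta] is the limit of [s (u n)] for an approximate unit [u] of [z]; the
   identity [p <s a, s a> = p (a^* z a)] gives convergence. *)
Lemma embed_of_inner (F : hilbertModType A) (s : adj_op (regmod A) F) (z : A) :
  (forall a b : regmod A, inner (s a) (s b) = smul (star a) (smul z b)) ->
  exists eta, s = embed eta.
Proof.
move=> sz.
have z_sa : star z = z.
  apply/eqP; rewrite -subr_eq0; apply/eqP/smul_eq0 => a b.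
  rewrite smulDl smulDr smulNl smulNr; apply/eqP; rewrite subr_eq0; apply/eqP.
  by rewrite -sz -inner_star sz !starM starK smulA.
have [u uP] := approximate_unit z_sa.
have [C C0 uC] : exists2 C : (A -> R) -> R,
    (forall p, Cstar_seminorm p -> 0 <= C p) &
    forall p, Cstar_seminorm p -> forall N,
    (forall c, p (c - smul c (u N)) <= C p * p c) /\
    p (z - smul z (u N)) <= C p / N.+1%:R.
  (* The sequence [u] serves all seminorms at once, while the constant depends on [p]; 0 is a
     default value when [p] is not a C*-seminorm. *)
  have /choice[C CP] : forall p, exists C, Cstar_seminorm p ->
      0 <= C /\ forall N, (forall c, p (c - smul c (u N)) <= C * p c) /\
      p (z - smul z (u N)) <= C / N.+1%:R.
    move=> p; have [/uP[C C0 CP]|Np] := pselect (Cstar_seminorm p);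
      last by exists 0.
    by exists C.
  by exists C => p Cp; have [] := CP p Cp.
have innerE a : inner (s a) (s a) = smul (star a) (smul z a) := sz a a.
(* Exchanging the factors puts [u N] on the right, where the estimate for [c - smul c (u N)]
   applies. *)
have flip (p : A -> R) (Cp : Cstar_seminorm p) a b :
    p (smul (star a) b) = p (smul (star b) a).
  by rewrite -(seminorm_star Cp) starM starK.
(* Both properties of [u] enter: [z (u N - u M)] is small, and right multiplication by [u N - u M]
   is bounded by [2 * C p]. *)
have p_diff (p : A -> R) (Cp : Cstar_seminorm p) N M :
    p (inner (s (u N - u M)) (s (u N - u M))) <=
    2 * C p * (C p * N.+1%:R^-1 + C p * M.+1%:R^-1).
  have [uN zN] := uC p Cp N; have [uM zM] := uC p Cp M.
  rewrite innerE; set y := smul z _.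
  have yE : p y <= C p * N.+1%:R^-1 + C p * M.+1%:R^-1.
    have -> : y = (z - smul z (u M)) - (z - smul z (u N)).
      by rewrite /y smulDr smulNr opprB addrCA addrAC subrr add0r addrC.
    by rewrite (le_trans (seminormB Cp _ _))// addrC lerD.
  rewrite flip// (@le_trans _ _ (2 * C p * p y))//; last first.
    by rewrite ler_wpM2l// mulr_ge0// C0.
  have -> : smul (star y) (u N - u M) =
      (star y - smul (star y) (u M)) - (star y - smul (star y) (u N)).
    by rewrite smulDr smulNr opprB addrCA addrAC subrr add0r addrC.
  rewrite (le_trans (seminormB Cp _ _))//.
  have := lerD (uM (star y)) (uN (star y)).
  by rewrite (seminorm_star Cp) -mulr2n -mulrA mulr_natl.
have p_right (p : A -> R) (Cp : Cstar_seminorm p) a N :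
    p (inner (s (a - smul (u N) a)) (s (a - smul (u N) a))) <=
    (C p * p a) ^+ 2 * N.+1%:R^-1.
  have [uN zN] := uC p Cp N.
  rewrite innerE; set y := smul z _.
  have yE : p y <= C p * N.+1%:R^-1 * p a.
    have -> : y = smul (z - smul z (u N)) a.
      by rewrite /y smulDr smulNr smulDl smulNl smulA.
    by rewrite (le_trans (seminormM Cp _ _))// ler_wpM2r// (seminorm_ge0 Cp).
  rewrite flip// (_ : smul _ _ = smul (star y - smul (star y) (u N)) a);
    last first.
    by rewrite smulDr smulNr smulDl smulNl smulA.
  rewrite (le_trans (seminormM Cp _ _))//.
  have := uN (star y); rewrite (seminorm_star Cp) =>
    /(ler_wpM2r (seminorm_ge0 Cp a))/le_trans; apply.
  have CA : 0 <= C p * p a by rewrite mulr_ge0 ?C0 ?(seminorm_ge0 Cp).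
  have h := ler_wpM2l CA yE; rewrite mulrAC (le_trans h)// le_eqVlt; apply/orP;
    left; apply/eqP; ring.
have sB a b : s a - s b = s (a - b) by rewrite adj_op_B.
have cauchy_su : cauchy ((fun n => s (u n)) @ \oo).
  move=> U; rewrite hnormsP => entU.
  have : \forall nm \near filter_prod \oo \oo, U (s (u nm.1), s (u nm.2)).
    apply: near_seminorm_entourage entU => q e [_ [p Sp <-] <-] e0.
    have [Cp _] := Sp; pose K := 4 * C p ^+ 2.
    have K0 : 0 <= K by rewrite mulr_ge0// sqr_ge0.
    have KP := near_natSinv_mul K0 (exprn_gt0 2 e0).
    exists ([set N | K * N.+1%:R^-1 < e ^+ 2],
      [set N | K * N.+1%:R^-1 < e ^+ 2]) => //=.
    move=> [N M] /= [hN hM]; rewrite hnormE lte_fin sB sqrtr_lt//.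
    rewrite (le_lt_trans (p_diff _ Cp _ _))//.
    rewrite (_ : 2 * C p * _ = (K * N.+1%:R^-1 + K * M.+1%:R^-1) / 2);
      last first.
      by rewrite /K; move: (N.+1%:R^-1) (M.+1%:R^-1) (C p) => x y c; field.
    by rewrite ltr_pdivrMr// mulr_natr mulr2n ltrD.
  move=> [[P1 P2] /= [oP1 oP2] P12U].
  exists ((fun n => s (u n)) @` P1, (fun n => s (u n)) @` P2) => /=.
    have fS (Q : set nat) : (\oo : set_system nat) Q ->
        (\oo : set_system nat) [set n | ((fun n => s (u n)) @` Q) (s (u n))].
      by apply: filterS => n Qn; exists n.
    by split; exact: fS.
  by move=> [_ _] /= [[n Pn <-] [m Pm <-]]; exact: (P12U (n, m)).
have [eta etaP] := hilbert_complete _ _ cauchy_su.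
exists eta; apply: adj_op_ext => a; apply: hilbert_eq => U entU.
(* Both sides are limits of [s (u n a) = s (u n) a]: it tends to [s a] by [p_right], and to [eta a]
   by continuity of the action of [a]. *)
have near1 : \forall n \near \oo, split_ent U (s a, s (smul (u n) a)).
  have := entourage_split_ent entU; rewrite hnormsP.
  apply: near_seminorm_entourage => q e [_ [p Sp <-] <-] e0.
  have [Cp _] := Sp.
  have := near_natSinv_mul (sqr_ge0 (C p * p a)) (exprn_gt0 2 e0).
  apply: filterS => N hN; rewrite hnormE lte_fin sB sqrtr_lt//.
  exact: le_lt_trans (p_right _ Cp _ _) hN.
have near2 : \forall x \near eta, split_ent U (ract x a, embed eta a).
  have := entourage_split_ent entU; rewrite hnormsP.
  apply: near_seminorm_entourage => q e [_ [p Sp <-] <-] e0.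
  have [Cp _] := Sp.
  have pa1 : 0 < p a + 1 by rewrite ltr_wpDl// (seminorm_ge0 Cp).
  have : entourage [set xy : F * F |
      (hnorm (fun a => (p a)%:E) (xy.1 - xy.2)%R < (e / (p a + 1))%:E)%E].
    rewrite hnormsP; apply: seminorm_entourage1; last by rewrite divr_gt0.
    by exists (fun a => (p a)%:E) => //; exists p.
  move/(nbhs_entourage eta); apply: filterS => x /xsectionP /=.
  rewrite !hnormE !lte_fin ltr_pdivlMr// -ractNl -ractDl -[x - eta]opprB ractNl.
  rewrite innerNN => h; apply: le_lt_trans (hnorm_ract _ _ Cp) _.
  by rewrite (le_lt_trans _ h)// ler_wpM2l ?sqrtr_ge0// lerDl.
have near3 : \forall n \near \oo, split_ent U (ract (s (u n)) a, embed eta a) :=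
  etaP _ near2.
have near13 : \forall n \near \oo, split_ent U (s a, s (smul (u n) a)) /\
    split_ent U (ract (s (u n)) a, embed eta a) by apply: filterI.
have /= [n [n1]] := filter_ex near13; rewrite -adj_op_smul => n2.
exact: entourage_split n1 n2.
Qed.

End Embedding.

(** * Operator seminorms and the norm of the multiplier module *)

Section OperatorNorms.
Context (R : realType) (A : locallyCstarType R) (p : A -> R).
Hypothesis Cp : Cstar_seminorm p.

Local Notation pe := (fun a : A => (p a)%:E).

Lemma hnorm_regmod (a : regmod A) : hnorm pe a = (p a)%:E.
Proof. by rewrite hnormE (seminorm_star_mul Cp) sqrtr_sqr ger0_norm//
  (seminorm_ge0 Cp). Qed.

Lemma hnorm0 (E : innerModType A) : hnorm pe (0 : E) = 0%E.
Proof. by rewrite hnormE inner0l (seminorm0 Cp) sqrtr0. Qed.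

Lemma opnorm_ge0 (E F : innerModType A) (T : adj_op E F) : (0 <= opnorm pe T)%E.
Proof.
apply: ereal_sup_ubound; exists 0; last by rewrite adj_op_0 hnorm0.
by rewrite /= hnorm0 lee_fin.
Qed.

(** By the C*-identity the supremum is attained at [star z] divided by [p z]. Applied to
    [z = inner x x], this makes [embed] isometric. *)
Lemma opnorm_left_mul (m : adj_op (regmod A) (regmod A)) (z : A) :
  (forall a : regmod A, m a = smul z a) -> opnorm pe m = (p z)%:E.
Proof.
move=> mz; apply/eqP; rewrite eq_le; apply/andP; split.
  apply: ge_ereal_sup => _ [a /= + <-]; rewrite !hnorm_regmod !lee_fin mz => a1.
  by rewrite (le_trans (seminormM Cp _ _))// ler_piMr// (seminorm_ge0 Cp).
have [->|z0] := eqVneq (p z) 0; first exact: opnorm_ge0.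
have {}z0 : 0 < p z by rewrite lt0r z0 (seminorm_ge0 Cp).
have z1 : 0 <= (p z)^-1 by rewrite invr_ge0 ltW.
apply: ereal_sup_ubound; exists (((p z)^-1)%:C *: star z : regmod A) => /=.
  by rewrite hnorm_regmod lee_fin (seminormZr Cp)// (seminorm_star Cp) mulVf//
    lt0r_neq0.
rewrite hnorm_regmod mz smulZr (seminormZr Cp)// -[X in smul X _]starK
  (seminorm_star_mul Cp) (seminorm_star Cp).
by rewrite expr2 mulrA mulVf ?mul1r// lt0r_neq0.
Qed.

Lemma opnorm_bound (E : innerModType A) (s : adj_op (regmod A) E) (M : R) a :
  0 <= M -> (opnorm pe s <= M%:E)%E -> p (inner (s a) (s a)) <= M ^+ 2 * p a ^+
    2.
Proof.
move=> M0 sM.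
have scaled (t : R) : 0 <= t -> t * p a <= 1 ->
    t ^+ 2 * p (inner (s a) (s a)) <= M ^+ 2.
  move=> t0 ta.
  have : (hnorm pe (s (t%:C *: a)) <= M%:E)%E.
    apply: le_trans sM; apply: ereal_sup_ubound; exists (t%:C *: a) => //=.
    by rewrite hnorm_regmod lee_fin (seminormZr Cp).
  rewrite hnormE lee_fin adj_op_Z innerZr innerZl scalerA mulrC conjcM_normc.
  rewrite normc_real// (seminormZr Cp) ?sqr_ge0// => h.
  by rewrite -[leLHS]sqr_sqrtr ?mulr_ge0 ?sqr_ge0 ?(seminorm_ge0 Cp)//
    ler_pXn2r ?nnegrE ?sqrtr_ge0.
set h := p (inner _ _) in scaled *.
have h0 : 0 <= h by exact: seminorm_ge0.
have [pa0|pa0] := eqVneq (p a) 0.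
  rewrite pa0 expr0n mulr0 leNgt; apply/negP => {}h0.
  have M1 : 0 <= M + 1 by rewrite addr_ge0.
  (* When [p a = 0] every multiple of [a] lies in the unit ball; this one would give
     [(M + 1)^2 <= M^2]. *)
  have := scaled ((M + 1) / Num.sqrt h); rewrite pa0 mulr0 => /(_ _ ler01).
  rewrite divr_ge0 ?sqrtr_ge0// => /(_ isT).
  rewrite expr_div_n sqr_sqrtr ?(ltW h0)// mulfVK ?lt0r_neq0//.
  by rewrite ler_pXn2r// gerDl ler10.
have pa1 : 0 < p a by rewrite lt0r pa0 (seminorm_ge0 Cp).
have := scaled (p a)^-1; rewrite invr_ge0 (ltW pa1) mulVf// lexx => /(_ isT
  isT).
by rewrite exprVn mulrC ler_pdivrMr ?exprn_gt0.
Qed.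

(* The inequality [<=] is where the numerical radius of the self-adjoint
   operator [s^* s] is compared with its norm. *)
Lemma hnorm_multMod (E : innerModType A) (s : multMod E) :
  @hnorm R (multAlg A) (multMod E) (@opnorm R A (regmod A) (regmod A) pe) s =
  @opnorm R A (regmod A) E pe s.
Proof.
apply/eqP; rewrite eq_le; apply/andP; split; last first.
  apply: ge_ereal_sup => _ [a /= + <-]; rewrite hnorm_regmod lee_fin => a1.
  rewrite /hnorm lee_sqrt ?opnorm_ge0//.
  apply: (@le_trans _ _ (p (adj_comp (adjoint s) s a))%:E); last first.
    apply: ereal_sup_ubound; exists a; last exact: hnorm_regmod.
    by rewrite /= hnorm_regmod lee_fin.
  rewrite lee_fin adjointP (le_trans (seminormM Cp _ _))// (seminorm_star Cp).
  by rewrite ler_piMl// (seminorm_ge0 Cp).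
have := @opnorm_ge0 (regmod A) E s.
case sM : (@opnorm R A (regmod A) E pe s) => [M| |];
  [|by move=> _; exact: leey|by []].
rewrite lee_fin => M0.
have -> : M%:E = sqrte (M ^+ 2)%:E by rewrite /= sqrtr_sqr ger0_norm.
rewrite /hnorm lee_sqrt ?lee_fin ?sqr_ge0//.
apply: ge_ereal_sup => _ [a /= + <-]; rewrite !hnorm_regmod !lee_fin => a1.
have sE x y : smul (star (adjoint s (s x))) y =
    smul (star x) (adjoint s (s y)) :> A.
  exact: etrans (esym (adjointPr s y (s x))) (adjointP s x (s y)).
have := @norm_le_numerical_radius R A p (fun a => adjoint s (s a)) (M ^+ 2) Cp
  (sqr_ge0 M) _ sE _ a.
move=> /(_ _ _)/le_trans; apply.
- by move=> k x y; rewrite !(adj_op_morph _).1.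
- move=> b; rewrite -[smul _ _](adjointP s b (s b)); apply: opnorm_bound => //.
  by rewrite sM.
- by rewrite ler_piMr// sqr_ge0.
Qed.
End OperatorNorms.

(** * Lifting operators to multiplier modules *)

Section Lift.
Context (R : realType) (A : locallyCstarType R).

Lemma adj_comp_adjointable (E F : innerModType A) (T : adj_op E F) :
  (fun s : multMod E => adj_comp T s : multMod F)
    \in @adjointable R (multAlg A) (multMod E) (multMod F).
Proof.
have morph (G H : innerModType A) (S : adj_op G H) :
    @module_morphism R (multAlg A) (multMod G) (multMod H)
      (fun s : multMod G => adj_comp S s : multMod H).
  split=> [k s t|s m]; last exact: adj_compA.
  by rewrite adj_compDr adj_compZr.
apply/asboolP; split; first exact: morph.
exists (fun t : multMod F => adj_comp (adjoint T) t : multMod E); first exact: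
  morph.
move=> s t; rewrite /inner/= /mult_inner adjoint_comp.
exact/esym/adj_compA.
Qed.

Definition lift (E F : innerModType A) (T : adj_op E F) :
    adj_op (multMod E) (multMod F) := AdjOp (adj_comp_adjointable T).

Lemma liftE (E F : innerModType A) (T : adj_op E F) (s : multMod E) :
  lift T s = adj_comp T s.
Proof. by []. Qed.

Lemma lift_linear (E F : innerModType A) : linear (@lift E F).
Proof. by move=> k S T; apply: adj_op_ext => s; apply: adj_op_ext. Qed.

Lemma lift_comp (E F G : innerModType A) (S : adj_op F G) (T : adj_op E F) :
  lift (adj_comp S T) = adj_comp (lift S) (lift T).
Proof. by apply: adj_op_ext => s; apply: adj_op_ext. Qed.

Lemma lift_adjoint (E F : innerModType A) (T : adj_op E F) :
  lift (adjoint T) = adjoint (lift T).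
Proof.
apply/esym/adjoint_uniq => s t.
rewrite /inner/= /mult_inner adjoint_comp; exact/esym/adj_compA.
Qed.

Lemma adj_comp_embed (E F : innerModType A) (T : adj_op E F) x :
  adj_comp T (embed x) = embed (T x).
Proof. by apply: adj_op_ext => a /=; rewrite (adj_op_morph T).2. Qed.

Lemma lift_inj (E F : innerModType A) : injective (@lift E F).
Proof.
move=> S T ST; apply: adj_op_ext => x; apply: embed_inj.
by rewrite -!adj_comp_embed -[LHS]liftE ST.
Qed.

Lemma inner_embed (E : innerModType A) (x y : E) (a : regmod A) :
  (inner (embed x : multMod E) (embed y : multMod E) : multAlg A) a =
  smul (inner x y) a.
Proof. by rewrite /inner/= /mult_inner /= adjoint_embedE inner_ract. Qed.

(** Through this identity an [M(A)]-module morphism on [M(E)] is determined by its values on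
    embedded elements. *)
Lemma embed_mulr (E : innerModType A) (s : multMod E) (a : A) :
  embed (s a) = ract s (embed (a : regmod A) : multAlg A).
Proof. by apply: adj_op_ext => b; rewrite embedE -adj_op_smul. Qed.

(** By [hnorm_multMod] the norms on both multiplier modules are operator norms, and for [s] and [a]
    in the unit balls [s a] is in the unit ball of [E]. Conversely, [embed] is isometric and
    intertwines [T] with [lift T]. *)
Lemma opnorm_lift (E F : innerModType A) (p : A -> R) (T : adj_op E F) :
  Cstar_seminorm p ->
  @opnorm R (multAlg A) (multMod E) (multMod F)
    (@opnorm R A (regmod A) (regmod A) (fun a => (p a)%:E)) (lift T) =
  @opnorm R A E F (fun a => (p a)%:E) T.
Proof.
move=> Cp; have hnorm_embed (G : innerModType A) (x : G) :
    @hnorm R (multAlg A) (multMod G)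
      (@opnorm R A (regmod A) (regmod A) (fun a => (p a)%:E)) (embed x) =
    @hnorm R A G (fun a => (p a)%:E) x.
  by rewrite /hnorm (opnorm_left_mul Cp (inner_embed x x)).
apply/eqP; rewrite eq_le; apply/andP; split.
  apply: ge_ereal_sup => _ [s /= + <-].
  rewrite !(hnorm_multMod Cp) => s1.
  apply: ge_ereal_sup => _ [a /= a1 <-].
  apply: ereal_sup_ubound; exists (s a) => //=.
  by apply: le_trans s1; apply: ereal_sup_ubound; exists a.
apply: ge_ereal_sup => _ [x /= x1 <-].
apply: ereal_sup_ubound; exists (embed x); rewrite /= ?hnorm_embed//.
by rewrite adj_comp_embed hnorm_embed.
Qed.

Lemma adj_op_embed (E F : hilbertModType A) (U : adj_op (multMod E) (multMod
  F)) (x : E) :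
  exists y : F, U (embed x) = embed y.
Proof.
pose r : multMod E := adjoint U (U (embed x)).
(* With [s = U (embed x)], [star s] times [s] sends [b] to [inner x (r b)], which equals the inner
   product of [adjoint r x] with [b]: left multiplication by [star (adjoint r x)]. *)
apply: (@embed_of_inner R A F (U (embed x)) (star (adjoint r x))) => a b.
have UU : inner (U (embed x)) (U (embed x)) = inner (embed x : multMod E) r :>
  multAlg A.
  exact: adjointP.
rewrite [LHS]adjointP.
rewrite -[adjoint _ _]/((inner (U (embed x)) (U (embed x)) : multAlg A) b) UU.
rewrite -[X in _ = smul _ X](adjointPr r (b : regmod A) x).
by congr smul; exact: adjoint_embedE.
Qed.

(** Elements are determined by their inner products, so a map with an adjoint is automatically
    linear. This serves for maps obtained by choice. *)
Lemma is_adjoint_morphism (E F : innerModType A) (T : E -> F) (S : F -> E) :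
  is_adjoint T S -> module_morphism T.
Proof.
move=> TS; have TSr w x : inner w (T x) = inner (S w) x :> A.
  by rewrite -inner_star TS inner_star.
split=> [k x y|x a]; apply: (@inner_extr R A F) => w.
  by rewrite innerDr innerZr !TSr innerDr innerZr.
by rewrite inner_ract !TSr inner_ract.
Qed.

(** [U] and its adjoint both preserve embedded elements; the induced maps [T] and [S] are adjoint to
    each other. Then [lift T] and [U] agree on embedded elements, hence everywhere by
    [embed_mulr]. *)
Lemma lift_surj (E F : hilbertModType A) (U : adj_op (multMod E) (multMod F)) :
  exists T, lift T = U.
Proof.
have [T UT] := choice (adj_op_embed U).
have [S US] := choice (adj_op_embed (adjoint U)).
have TS : is_adjoint T S.
  move=> x y; apply/eqP; rewrite -subr_eq0; apply/eqP/smul_eq0 => b a.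
  rewrite smulDl smulNl -!inner_embed -UT -US.
  by rewrite (adjointP U) subrr smul0r.
have ST : is_adjoint S T by move=> y x; rewrite -inner_star -TS inner_star.
have TP : T \in @adjointable R A E F.
  apply/asboolP; split; first exact: is_adjoint_morphism TS.
  by exists S => //; exact: is_adjoint_morphism ST.
exists (AdjOp TP); apply: adj_op_ext => s; apply: adj_op_ext => a.
apply: embed_inj; apply: etrans (esym (UT (s a))) _.
by rewrite !embed_mulr (adj_op_morph U).2.
Qed.

Section LiftSeminorms.
Context (E F : hilbertModType A).

Let QE : set (adj_op E F -> \bar R) :=
  [set @opnorm R A E F p | p in cont_Cstar_seminormsE A].
Let QM : set (adj_op (multMod E) (multMod F) -> \bar R) :=
  [set @opnorm R (multAlg A) (multMod E) (multMod F) p | p in @multSeminorms R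
    A].

Lemma lift_seminorm q : QM q -> QE (q \o @lift E F).
Proof.
move=> [_ [_ [p Sp <-] <-] <-]; exists (fun a => (p a)%:E); first by exists p.
by apply/funext => T; rewrite /= opnorm_lift//; case: Sp.
Qed.

Lemma lift_inv_seminorm (f : adj_op (multMod E) (multMod F) -> adj_op E F) q :
  cancel f (@lift E F) -> QE q -> QM (q \o f).
Proof.
move=> fK [_ [p Sp <-] <-].
exists (@opnorm R A (regmod A) (regmod A) (fun a => (p a)%:E)).
  by exists (fun a => (p a)%:E) => //; exists p.
by apply/funext => U; rewrite /= -[in LHS](fK U) opnorm_lift//; case: Sp.
Qed.

End LiftSeminorms.

End Lift.

(** * Continuity in seminorm topologies, and the isomorphisms *)

Section SeminormSpace.
Context (R : realType).

Lemma seminorm_space_continuous (X : topologicalType) (V : lmodType R[i])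
    (Q : set (V -> \bar R)) (f : X -> seminorm_space Q) :
  (forall B, seminorm_balls Q B -> open (f @^-1` B)) -> continuous f.
Proof.
move=> fB x U [W [[D DQ <-] [B DB Bfx] WU]].
have [S SQ SB] := DQ _ DB.
have : nbhs x (\bigcap_(C in [set` S]) f @^-1` C).
  apply: filter_bigI => C CS; apply: open_nbhs_nbhs; split.
    apply: fB; have := SQ _ CS; rewrite inE; exact.
  by move: Bfx; rewrite -SB; exact.
apply: filterS => y yS; apply: WU; exists B => //.
suff : (B : set V) (f y) by [].
by rewrite -SB => C CS; exact: yS.
Qed.

Lemma open_seminorm_ball (V : lmodType R[i]) (Q : set (V -> \bar R)) B :
  seminorm_balls Q B -> open (B : set (seminorm_space Q)).
Proof.
move=> QB; exists [set B]; last by rewrite bigcup_set1.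
move=> _ ->; exists [fset (B : set V)]%fset; last by rewrite set_fset1
  bigcap_set1.
by move=> C /fset1P ->; rewrite inE.
Qed.

(** The preimage under [f] of the [q]-ball about [y] is the ball of [q \o f] about [g y] with the
    same radius, so subbasic sets pull back to subbasic sets. *)
Lemma seminorm_isometry_continuous (V W : lmodType R[i])
    (QV : set (V -> \bar R)) (QW : set (W -> \bar R))
    (f : V -> W) (g : W -> V) :
  linear f -> cancel g f -> (forall q, QW q -> QV (q \o f)) ->
  continuous (f : seminorm_space QV -> seminorm_space QW).
Proof.
move=> fl gK fQ.
have fE x y : f (x - g y) = f x - y by rewrite addrC -scaleN1r fl gK scaleN1r
  addrC.
 apply: seminorm_space_continuous => _ [q [y [e [Qq e0 ->]]]].
apply: open_seminorm_ball; exists (q \o f), (g y), e; split=> //; first exact: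
  fQ.
by apply/seteqP; split=> x /=; rewrite fE.
Qed.

End SeminormSpace.

Theorem theorem4p1 (R : realType) (A : locallyCstarType R)
    (E F : hilbertModType A) :
  lcs_isomorphic (LMA E F) (LA E F) /\
  locallyCstar_isomorphic (LMA_alg E) (LA_alg E).
Proof.
(* The isomorphisms go from the multiplier side down, so they are the inverses of [lift], chosen by
   surjectivity. *)
have [f0 liftK0] := choice (@lift_surj R A E F).
have [f1 liftK1] := choice (@lift_surj R A E E).
have f0K : cancel f0 (@lift R A E F) := liftK0.
have f1K : cancel f1 (@lift R A E E) := liftK1.
have lift0K := inj_can_sym f0K (@lift_inj R A E F).
have lift1K := inj_can_sym f1K (@lift_inj R A E E).
have lin (V W : lmodType R[i]) (f : V -> W) (g : W -> V) :
    linear f -> cancel f g -> cancel g f -> linear g.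
  by move=> fl fK gK k x y; rewrite -[in LHS](gK x) -[in LHS](gK y) -fl fK.
split.
  exists f0, (@lift R A E F); split=> //.
  - exact: lin (@lift_linear R A E F) lift0K f0K.
  - apply: (@seminorm_isometry_continuous _ _ _ _ _ f0 (@lift R A E F)) => //.
      exact: lin (@lift_linear R A E F) lift0K f0K.
    by move=> q; exact: lift_inv_seminorm.
  - apply: (@seminorm_isometry_continuous _ _ _ _ _ (@lift R A E F) f0) => //.
      exact: lift_linear.
    exact: lift_seminorm.
exists f1, (@lift R A E E); split=> //; split.
- split.
  + exact: lin (@lift_linear R A E E) lift1K f1K.
  + move=> U V; apply: lift_inj; rewrite [LHS]f1K.
    by apply/esym; rewrite [LHS]lift_comp !f1K.
  + move=> U; apply: lift_inj; rewrite [LHS]f1K.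
    by apply/esym; rewrite [LHS]lift_adjoint f1K.
- apply: (@seminorm_isometry_continuous R (endo_op (multMod E)) (endo_op E) _ _
  f1 (@lift R A E E)) => //.
    exact: lin (@lift_linear R A E E) lift1K f1K.
  by move=> q; exact: lift_inv_seminorm.
- split; [exact: lift_linear|exact: lift_comp|exact: lift_adjoint].
- apply: (@seminorm_isometry_continuous R (endo_op E) (endo_op (multMod E)) _ _
  (@lift R A E E) f1) => //.
    exact: lift_linear.
  exact: lift_seminorm.
Qed.
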